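(* There exist coefficient functions $\tilde e_C,\tilde e_S$ of $\lambda$, defined for all sufficiently large $\lambda$ and satisfying $$\pi^2\le\tilde e_C(\lambda)\le3\pi^2,\qquad \pi^2\le\tilde e_S(\lambda)\le3\pi^2,$$ such that, as $\lambda\to\infty$, $$e_C(\lambda)=-\pi^2\lambda\log\left(\frac{\pi^2\lambda}2\right)+\tilde e_C(\lambda)\,\lambda+O(1),$$ $$e_S(\lambda)=-\pi^2\lambda\log\left(\frac{\pi^2\lambda}2\right)+\tilde e_S(\lambda)\,\lambda+O(1).$$
   Context: $|E|$ denotes Lebesgue measure on $\mathbb R^2$ and $P$ the usual (De Giorgi) perimeter. For measurable $E\subset\mathbb R^2$ the connected perimeter is $$\overline{P^r_C}(E)=\inf\{\liminf_{n\to\infty}P(E_n)\mid E_n\to E\text{ in }L^1,\ E_n\text{ connected and }C^\infty\text{-smooth}\},$$ and the simply connected perimeter is $$\overline{P^r_S}(E)=\inf\{\liminf_{n\to\infty}P(E_n)\mid E_n\to E\text{ in }L^1,\ E_n\text{ simply connected and }C^\infty\text{-smooth}\}.$$ Here $E_n\to E$ in $L^1$ means $\chi_{E_n}\to\chi_E$ in $L^1(\mathbb R^2)$. For $\lambda>0$, $$\mathcal F^\lambda_C(\chi_E)=\overline{P^r_C}(E)+\lambda\int_E\int_E\log\left(\frac1{|x-y|}\right)\,\mathrm dx\,\mathrm dy,\qquad \mathcal F^\lambda_S(\chi_E)=\overline{P^r_S}(E)+\lambda\int_E\int_E\log\left(\frac1{|x-y|}\right)\,\mathrm dx\,\mathrm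 dy,$$ each understood to be $+\infty$ when the corresponding relaxed perimeter is $+\infty$. The minimal energies are $$e_C(\lambda)=\min\{\mathcal F^\lambda_C(\chi_E)\mid E\subseteq\mathbb R^2\text{ measurable},\ |E|=\pi\},\qquad e_S(\lambda)=\min\{\mathcal F^\lambda_S(\chi_E)\mid E\subseteq\mathbb R^2\text{ measurable},\ |E|=\pi\}$$ (these minima are attained for every $\lambda>0$). *)

(* Defs.v *)
From HB Require Import structures.
From mathcomp Require Import all_boot all_order all_algebra.
From mathcomp Require Import all_classical all_reals all_analysis.

Set Implicit Arguments.
Unset Strict Implicit.
Unset Printing Implicit Defensive.

Import Order.TTheory GRing.Theory Num.Theory.
Import numFieldNormedType.Exports.

Local Open Scope classical_set_scope.
Local Open Scope ring_scope.

(* The plane is [R * R]; [measurable] refers to its Borel sets.  A Lebesgue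
   measurable set agrees with a Borel set up to a null set, and every quantity
   below that depends on a measurable set only depends on its class modulo
   null sets. *)
Notation lebesgue2 R :=
  ((@lebesgue_measure R) \x (@lebesgue_measure R))%E (only parsing).

Section Plane.
Context {R : realType}.
Implicit Types (x y : R * R) (E A : set (R * R)).

(* The library norm on [R * R] is the sup norm. *)
Definition enorm x : R := Num.sqrt (x.1 ^+ 2 + x.2 ^+ 2).

Definition C1c (f : R * R -> R) : Prop :=
  [/\ compact (closure [set x | f x != 0]),
      (forall x, derivable f x (1, 0)) /\ (forall x, derivable f x (0, 1)),
      continuous (fun x => 'D_((1, 0) : R * R) f x) &
      continuous (fun x => 'D_((0, 1) : R * R) f x)].

Definition divergence (f g : R * R -> R) x : R :=
  'D_((1, 0) : R * R) f x + 'D_((0, 1) : R * R) g x.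

Definition perimeter E : \bar R :=
  ereal_sup [set v | exists f g : R * R -> R,
    [/\ C1c f, C1c g, (forall x, enorm (f x, g x) <= 1) &
        v = (\int[lebesgue2 R]_(x in E) (divergence f g x)%:E)%E]].

Definition boundary E : set (R * R) := closure E `&` closure (~` E).

(* Near each boundary point, in a square centred there, the set is the open
   region strictly on one side of the graph of a smooth function of one of the
   two coordinates.  Such a set is open. *)
Definition smooth_set E : Prop :=
  forall a, boundary E a -> exists (r : R) (h : R -> R), 0 < r /\
   (((forall n t, `|t - a.1| < r -> derivable (derive1n n h) t 1) /\
     ((forall x, ball a r x -> (E x <-> h x.1 < x.2)) \/
      (forall x, ball a r x -> (E x <-> x.2 < h x.1)))) \/
    ((forall n t, `|t - a.2| < r -> derivable (derive1n n h) t 1) /\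
     ((forall x, ball a r x -> (E x <-> h x.2 < x.1)) \/
      (forall x, ball a r x -> (E x <-> x.1 < h x.2))))).

Definition path_connected E : Prop :=
  forall x y, E x -> E y -> exists g : R -> R * R,
    [/\ {within `[0, 1], continuous g}, g 0 = x, g 1 = y &
        forall t, 0 <= t <= 1 -> E (g t)].

Definition null_homotopic_in E (g : R -> R * R) : Prop :=
  exists H : R * R -> R * R,
    [/\ {within `[0, 1] `*` `[0, 1], continuous H},
        (forall s t, 0 <= s <= 1 -> 0 <= t <= 1 -> E (H (s, t))),
        (forall t, 0 <= t <= 1 -> H (0, t) = g t /\ H (1, t) = g 0) &
        (forall s, 0 <= s <= 1 -> H (s, 0) = g 0 /\ H (s, 1) = g 0)].

Definition simply_connected E : Prop :=
  path_connected E /\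
  forall g : R -> R * R, {within `[0, 1], continuous g} ->
    (forall t, 0 <= t <= 1 -> E (g t)) -> g 0 = g 1 -> null_homotopic_in E g.

Definition connected_smooth : set (set (R * R)) :=
  [set A | connected A /\ smooth_set A].

Definition simply_connected_smooth : set (set (R * R)) :=
  [set A | simply_connected A /\ smooth_set A].

Definition cvg_L1 (En : nat -> set (R * R)) E : Prop :=
  ((fun n => \int[lebesgue2 R]_x `|(\1_(En n) x : R) - \1_E x|%:E) @ \oo
     --> 0)%E.

Definition relaxed_perimeter (C : set (set (R * R))) E : \bar R :=
  ereal_inf [set v | exists En : nat -> set (R * R),
    [/\ (forall n, C (En n)), cvg_L1 En E &
        v = limn_einf (fun n => perimeter (En n))]].

(* On the null set [x = y] the integrand is [ln 0^-1 = 0]. *)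
Definition log_energy E : \bar R :=
  (\int[lebesgue2 R]_(x in E) \int[lebesgue2 R]_(y in E)
     (ln (enorm (x - y))^-1)%:E)%E.

Definition energy (C : set (set (R * R))) (lam : R) E : \bar R :=
  if relaxed_perimeter C E == +oo%E then +oo%E
  else (relaxed_perimeter C E + lam%:E * log_energy E)%E.

(* For [connected_smooth] and [simply_connected_smooth] with [0 < lam] the
   infimum is attained, hence equal to the minimum. *)
Definition min_energy (C : set (set (R * R))) (lam : R) : \bar R :=
  ereal_inf [set energy C lam E | E in
    [set E : set (R * R) |
      measurable (E : set (measurableTypeR R * measurableTypeR R)) /\
      lebesgue2 R E = pi%:E]].

End Plane.

Definition e_C {R : realType} (lam : R) : \bar R :=
  min_energy connected_smooth lam.

Definition e_S {R : realType} (lam : R) : \bar R :=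
  min_energy simply_connected_smooth lam.

(* Main.v *)
(** Write [c = pi^2 lam].

    Lower bound.  A connected open set [A] of finite area has perimeter at least
    twice its diameter: on the lines orthogonal to a chord of [A], test with a
    field that jumps from -1 to 1 inside [A] and returns to 0 slowly.  Along an
    approximating sequence this shows that almost all pairs of points of [E] are
    at distance at most [q / 2], for every [q] above the relaxed perimeter, so
    the logarithmic energy is at least [- pi^2 ln (q / 2)].  Finally
    [q - c ln (q / 2)] is minimal at [q = c].

    Upper bound.  Both minima are at most the energy of the convex smooth set
    [(x / a)^8 + (y / b)^8 < 1] with [a = c / 4] and area [pi].  Its perimeter is
    at most [4 a + 4 b], and [ln (1 / |x - y|) <= - ln a + max 0 (ln (a / |x1 - y1|))],
    where the last term has integral at most [4 a b <= (100 / 81) pi] over the set.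
    Since [1 + ln 2 + 100 / 81 <= 3], this gives the bound. *)

Require Import Defs.
From HB Require Import structures.
From mathcomp Require Import all_boot all_order all_algebra.
From mathcomp Require Import all_classical all_reals all_analysis.
From mathcomp Require Import measurable_realfun.
From mathcomp Require Import ring lra.

Set Implicit Arguments.
Unset Strict Implicit.
Unset Printing Implicit Defensive.

Import Order.TTheory GRing.Theory Num.Theory.
Import numFieldNormedType.Exports.

Local Open Scope classical_set_scope.
Local Open Scope ring_scope.

(** The lower bound uses connectedness through a single fact: a linear form maps a connected set
    onto an interval. Every level between the ends of a chord therefore meets the open set [A], and
    test fields built near single points are concatenated level by level; no curve and no structure
    of the boundary enters. The loss of 1 in the lower bound arises because approximating sets only
    reach numbers [q] strictly above the relaxed perimeter.

    For the upper bound the natural competitor is a long rectangle, with [4 a b = pi], but it is not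
    smooth. An ellipse is smooth, but its inscribed rectangles only give [4 a b <= 2 pi], more than
    the available [(2 - ln 2) pi]. The exponent 8 brings the curve close to a rectangle and, being a
    power of two, lets convexity follow by repeated squaring. The area itself is never computed.

    The estimates hold for any class of connected smooth sets that contains the superellipses, so
    both energies are instances. The coefficient functions are the normalized remainders, cut off to
    the allowed interval. *)

Notation mplane R := (measurableTypeR R * measurableTypeR R)%type (only parsing).

(** * Borel sets and continuous functions on the plane *)

Section PlaneMeasurability.
Context {R : realType}.

(** Measurability in [mplane R] refers to the product sigma-algebra, so an open set has to be
    exhausted by countably many boxes; those with rational corners suffice. *)
Lemma open_plane_measurable (A : set (R * R)) :
  open A -> measurable (A : set (mplane R)).
Proof.
move=> oA.
pose box (i : rat * rat * (rat * rat)) : set (mplane R) :=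
  `]ratr i.1.1, ratr i.1.2[%classic `*` `]ratr i.2.1, ratr i.2.2[%classic.
have -> : A = \bigcup_(i in [set i | box i `<=` A]) box i.
  apply/seteqP; split => [x Ax|x [i iA]]; last exact: iA.
  have [e /= e0 eA] : \forall e \near 0^'+, ball x e `<=` A.
    exact: open_subball.
  have e20 : 0 < e / 2 by rewrite divr_gt0.
  have {}eA : ball x (e / 2) `<=` A.
    by apply: eA => //=; rewrite sub0r normrN gtr0_norm// ltr_pdivrMr// ltr_pMr// ltr1n.
  have q (y : R) : exists2 p : rat * rat, y - e / 2 < ratr p.1 < y &
      y < ratr p.2 < y + e / 2.
    have [|a /andP[a1 a2]] := @rat_in_itvoo R (y - e / 2) y; first by rewrite ltrBlDr ltrDl.
    have [|b /andP[b1 b2]] := @rat_in_itvoo R y (y + e / 2); first by rewrite ltrDl.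
    by exists (a, b) => /=; apply/andP; rewrite ?(itvP a1) ?(itvP b1).
  have [p1 /andP[p11 p12] /andP[p13 p14]] := q x.1.
  have [p2 /andP[p21 p22] /andP[p23 p24]] := q x.2.
  exists (p1, p2).
    move=> y [/=]; rewrite !in_itv/= => /andP[a1 a2] /andP[b1 b2]; apply: eA.
    by split; rewrite /ball/= ltr_distlC; apply/andP; split; lra.
  by split => /=; rewrite in_itv/=; apply/andP.
rewrite bigcup_mkcond; apply: countable_bigcupT_measurable => [|i]; first exact: countableP.
by case: ifPn => // _; apply: measurableX.
Qed.

Lemma continuous_plane_measurable (f : R * R -> R) :
  continuous f -> measurable_fun setT (f : mplane R -> measurableTypeR R).
Proof.
move=> cf; apply: (measurability _ (RGenOpens.measurableE R)) => _ [_ [a [b ->] <-]].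
rewrite setTI; apply: open_plane_measurable.
by apply: open_comp => // x _; exact: cf.
Qed.

End PlaneMeasurability.

(** Carrying the derivative as an explicit second function keeps the formulas for products and
    compositions available for rewriting. *)
Definition C1_pair {R : realType} (f g : R -> R) : Prop :=
  (forall x : R, is_derive x (1 : R) f (g x)) /\ continuous g.

(** * One-dimensional cutoff functions of class C^1 *)

Section Splines.
Context {R : realType}.
Implicit Types f g : R -> R.

(** The difference quotient at 0 is [g] itself. This handles the gluing point of [possq], where [g]
    is only continuous. *)
Lemma is_derive_mul_id (g : R -> R) : {for 0, continuous g} ->
  is_derive (0 : R) (1 : R) (fun x => x * g x) (g 0).
Proof.
move=> cg.
have dg : (fun h : R => h^-1 *: (((fun x : R => x * g x) \o shift 0) (h *: 1)
    - 0 * g 0)) @ 0^' --> g 0.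
  apply: (@cvg_trans _ (g @ 0^')); last exact: cvg_within_filter.
  apply: near_eq_cvg; near=> h.
  rewrite /= mul0r subr0 addr0 [h *: 1]mulr1 /GRing.scale/= mulrA mulVf ?mul1r//.
  by near: h; exact: nbhs_dnbhs_neq.
by split; [apply/cvg_ex; exists (g 0)|exact/cvg_lim].
Unshelve. all: by end_near. Qed.

(** The square of the positive part, the basic quadratic spline. *)
Let possq (x : R) := x * Num.max x 0.

Lemma is_derive_possq (x : R) : is_derive x (1 : R) possq (2 * Num.max x 0).
Proof.
have cm : continuous (fun x : R => Num.max x 0).
  by move=> y; apply: continuous_max => //; exact: cst_continuous.
have [x0|x0|->] := ltgtP x 0.
- rewrite mulr0.
  apply: (@near_eq_is_derive _ _ _ (fun=> 0)).
  by near=> y; rewrite /possq max_r ?mulr0// ltW//; near: y; exact: lt_nbhsl.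
- apply: (@near_eq_is_derive _ _ _ (fun y : R => y * y)).
    by near=> y; rewrite /possq max_l// ltW//; near: y; exact: lt_nbhsr.
  by apply: is_derive_eq; rewrite /GRing.scale/=; ring.
- by apply: is_derive_eq (is_derive_mul_id (cm 0)) _; rewrite maxxx mulr0.
Unshelve. all: by end_near. Qed.

Lemma C1_pair_comp_affine (f g : R -> R) (a b : R) : C1_pair f g ->
  C1_pair (fun x => f (a * x + b)) (fun x => a * g (a * x + b)).
Proof.
move=> [fg cg]; split=> x.
  have fgx := fg (a * x + b).
  have : is_derive x (1 : R) (fun x => a * x + b) a.
    by apply: is_derive_eq; rewrite /GRing.scale/=; ring.
  by move=> /(@is_derive1_comp _ f _ x _ _ fgx); rewrite mulrC.
apply: cvgM; first exact: cvg_cst.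
apply: (@continuous_comp _ _ _ (fun x => a * x + b)); last exact: cg.
by apply: cvgD; [apply: cvgM; [exact: cvg_cst|exact: cvg_id]|exact: cvg_cst].
Qed.

Lemma C1_pair_mul (f g f' g' : R -> R) : C1_pair f f' -> C1_pair g g' ->
  C1_pair (fun x => f x * g x) (fun x => f x * g' x + g x * f' x).
Proof.
move=> [df cf] [dg cg].
have c h h' (dh : forall x : R, is_derive x (1 : R) h (h' x)) : continuous (h : R -> R).
  by move=> x; apply/differentiable_continuous/derivable1_diffP; case: (dh x).
split=> x; first by have := dg x; have := df x => ? ?; exact: is_derive_eq.
by apply: cvgD; apply: cvgM; [exact: c df x|exact: cg|exact: c dg x|exact: cf].
Qed.

Lemma C1_pair_lin (f g f' g' : R -> R) (a b : R) : C1_pair f f' -> C1_pair g g' ->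
  C1_pair (fun x => a * f x + b * g x) (fun x => a * f' x + b * g' x).
Proof.
move=> [df cf] [dg cg]; split=> x.
  by have := dg x; have := df x => ? ?; exact: is_derive_eq.
by apply: cvgD; apply: cvgM; [exact: cvg_cst|exact: cf|exact: cvg_cst|exact: cg].
Qed.

(** [H] is the quadratic spline with knots 0, 1/2 and 1 whose derivative is the tent of height 2; as
    a combination of truncated squares it is C^1 without any gluing. *)
Lemma C1_step : exists H H' : R -> R, [/\ C1_pair H H',
  (forall x, x <= 0 -> H x = 0 /\ H' x = 0),
  (forall x, 1 <= x -> H x = 1 /\ H' x = 0),
  (forall x, 0 <= H x <= 1) & (forall x, 0 <= H' x <= 2)].
Proof.
pose p (x : R) := Num.max x 0.
have Cp : C1_pair possq (fun x => 2 * p x).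
  split; first exact: is_derive_possq.
  move=> x; apply: cvgM; first exact: cvg_cst.
  by apply: continuous_max => //; exact: cst_continuous.
(* The factors [1 *] and the shift [+ 0] reproduce the shape of [C1_pair_lin] and
   [C1_pair_comp_affine], which then apply up to conversion. *)
pose H x := 1 * (2 * possq (1 * x + 0) + (- 4) * possq (1 * x + (- 2^-1))) +
  2 * possq (1 * x + (- 1)).
pose H' x := 1 * (2 * (1 * (2 * p (1 * x + 0))) + (- 4) * (1 * (2 * p (1 * x + (- 2^-1))))) +
  2 * (1 * (2 * p (1 * x + (- 1)))).
have pE x : (0 <= x -> p x = x) /\ (x <= 0 -> p x = 0).
  by rewrite /p; split => ?; [rewrite max_l|rewrite max_r].
have E x : [\/ [/\ x <= 0, H x = 0 & H' x = 0],
    [/\ 0 <= x <= 2^-1, H x = 2 * x ^+ 2 & H' x = 4 * x],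
    [/\ 2^-1 <= x <= 1, H x = 1 - 2 * (1 - x) ^+ 2 & H' x = 4 * (1 - x)] |
    [/\ 1 <= x, H x = 1 & H' x = 0]].
  rewrite /H /H' /possq -!/(p _) !mul1r !addr0.
  have [a1 a2] := pE x; have [b1 b2] := pE (x - 2^-1); have [c1 c2] := pE (x - 1).
  have [x0|x0] := leP x 0; [constructor 1|have [x1|x1] := leP x 2^-1;
    [constructor 2|have [x2|x2] := leP x 1; [constructor 3|constructor 4]]].
  - by rewrite a2// b2 ?c2; [split=> //; ring|lra|lra].
  - by rewrite a1 ?b2 ?c2; [split; [lra|ring|ring]|lra|lra|lra].
  - by rewrite a1 ?b1 ?c2; [split; [lra|field|field]|lra|lra|lra].
  - by rewrite a1 ?b1 ?c1; [split; [lra|field|field]|lra|lra|lra].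
exists H, H'; split.
- have A b := C1_pair_comp_affine 1 b Cp.
  exact: (C1_pair_lin 1 2 (C1_pair_lin 2 (- 4) (A 0) (A (- 2^-1))) (A (- 1))).
- by move=> x x0; case: (E x) => [] [] x1 -> ->; rewrite ?expr2; split => //; nra.
- by move=> x x0; case: (E x) => [] [] x1 -> ->; rewrite ?expr2; split => //; nra.
- by move=> x; case: (E x) => [] [] x1 -> _; rewrite ?expr2; nra.
- by move=> x; case: (E x) => [] [] x1 _ ->; nra.
Qed.

(** The product of an increasing and a decreasing step, each with a ramp of length [e] and slope at
    most [2 / e]. For [b - a < 2 * e] the plateau is empty and the other bounds still hold. *)
Lemma C1_plateau (a b e : R) : 0 < e -> exists f f' : R -> R, [/\ C1_pair f f',
  (forall x, 0 <= f x <= 1),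
  (forall x, ~~ (a < x < b) -> f x = 0),
  (forall x, a + e <= x <= b - e -> f x = 1 /\ f' x = 0) &
  (forall x, `|f' x| <= 4 / e)].
Proof.
move=> e0; have [H [H' [CH H0 H1 H01 H'02]]] := C1_step.
exists (fun x => H (e^-1 * x + (- a / e)) * H ((- e^-1) * x + b / e)).
exists (fun x => H (e^-1 * x + (- a / e)) * (- e^-1 * H' (- e^-1 * x + b / e)) +
  H (- e^-1 * x + b / e) * (e^-1 * H' (e^-1 * x + (- a / e)))); split.
- apply: (@C1_pair_mul (fun x => H (e^-1 * x + (- a / e))) (fun x => H (- e^-1 * x + b / e)));
    exact: C1_pair_comp_affine.
- move=> x; have := H01 (e^-1 * x + (- a / e)); have := H01 ((- e^-1) * x + b / e).
  by nra.
- move=> x; rewrite negb_and -!leNgt => /orP[] xab.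
    rewrite (H0 (e^-1 * x + (- a / e)) _).1 ?mul0r//.
    by rewrite (_ : _ + _ = (x - a) / e); [rewrite pmulr_lle0 ?invr_gt0//; lra|field; lra].
  rewrite (H0 (- e^-1 * x + b / e) _).1 ?mulr0//.
  by rewrite (_ : _ + _ = (b - x) / e); [rewrite pmulr_lle0 ?invr_gt0//; lra|field; lra].
- move=> x xab.
  have /H1[-> ->] : 1 <= e^-1 * x + (- a / e).
    by rewrite (_ : _ + _ = (x - a) / e); [rewrite ler_pdivlMr//; lra|field; lra].
  have /H1[-> ->] : 1 <= (- e^-1) * x + b / e.
    by rewrite (_ : _ + _ = (b - x) / e); [rewrite ler_pdivlMr//; lra|field; lra].
  by split; ring.
- move=> x.
  have := H01 (e^-1 * x + (- a / e)); have := H01 ((- e^-1) * x + b / e).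
  have := H'02 (e^-1 * x + (- a / e)); have := H'02 ((- e^-1) * x + b / e).
  set u := H _; set v := H _; set u' := H' _; set v' := H' _.
  move=> /andP[? ?] /andP[? ?] /andP[? ?] /andP[? ?].
  rewrite (_ : _ + _ = (u * v' - v * u') / e); last by ring.
  rewrite normrM [`|e^-1|]gtr0_norm ?invr_gt0// ler_pM2r ?invr_gt0//.
  by rewrite ler_norml; apply/andP; split; nra.
Qed.

(** A monotone step from -1 to 1 times a wide plateau. Within distance [d] of [q] the plateau is
    constant, beyond it the step is constant, so the derivative is that of one factor up to sign. *)
Lemma C1_swing (q d k : R) : 0 < d -> 0 < k -> exists (K : R) (f f' : R -> R),
  [/\ C1_pair f f', (forall x, `|f x| <= 1),
  (forall x, K <= `|x - q| -> f x = 0),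
  f (q + d) = 1 /\ f (q - d) = -1 &
  forall x, (`|x - q| <= d -> 0 <= f' x) /\ (d <= `|x - q| -> `|f' x| <= k)].
Proof.
move=> d0 k0; have [H [H' [CH H0 H1 H01 H'02]]] := C1_step.
(* Ramps of length [4 / k] give the plateau a slope of at most [k]. *)
have e0 : 0 < 4 / k by rewrite divr_gt0.
have [p [p' [Cp p01 p0 p1 p'k]]] := C1_plateau (q - d - 4 / k) (q + d + 4 / k) e0.
have C1 : C1_pair (fun=> 1 : R) (fun=> 0 : R).
  by split=> x; [exact: is_derive_eq|exact: cst_continuous].
pose h x := 2 * H ((2 * d)^-1 * x + ((d - q) / (2 * d))) + (-1) * 1.
pose h' x := 2 * ((2 * d)^-1 * H' ((2 * d)^-1 * x + ((d - q) / (2 * d)))) + (-1) * 0.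
have Ch : C1_pair h h' by apply: C1_pair_lin => //; exact: C1_pair_comp_affine.
have aE x : (2 * d)^-1 * x + ((d - q) / (2 * d)) = (x - q + d) / (2 * d) by ring.
have hR x : q + d <= x -> h x = 1 /\ h' x = 0.
  move=> xq; have [] := H1 ((2 * d)^-1 * x + ((d - q) / (2 * d))).
    by rewrite aE ler_pdivlMr; lra.
  by rewrite /h /h' => -> ->; split; ring.
have hL x : x <= q - d -> h x = -1 /\ h' x = 0.
  move=> xq; have [] := H0 ((2 * d)^-1 * x + ((d - q) / (2 * d))).
    by rewrite aE ler_pdivrMr ?mul0r; lra.
  by rewrite /h /h' => -> ->; split; ring.
have h1 x : `|h x| <= 1.
  by rewrite /h ler_norml; have := H01 ((2 * d)^-1 * x + ((d - q) / (2 * d))); lra.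
have h'0 x : 0 <= h' x.
  rewrite /h' mulr0 addr0 !mulr_ge0// ?invr_ge0; first lra.
  by have /andP[] := H'02 ((2 * d)^-1 * x + ((d - q) / (2 * d))).
have pin x : `|x - q| <= d -> p x = 1 /\ p' x = 0.
  by rewrite ler_norml => ?; apply: p1; lra.
exists (d + 4 / k), (fun x => h x * p x), (fun x => h x * p' x + p x * h' x); split.
- exact: C1_pair_mul.
- move=> x; rewrite normrM; have /andP[? ?] := p01 x; rewrite (ger0_norm (_ : 0 <= p x))//.
  by have := h1 x; have := normr_ge0 (h x); nra.
- move=> x; rewrite ler_normr => xq; rewrite p0 ?mulr0//; apply/negP => /andP[? ?].
  by case/orP: xq; lra.
- rewrite (pin (q + d) _).1 ?(pin (q - d) _).1 ?mulr1.
  + by rewrite (hR _ _).1 ?(hL _ _).1.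
  + by rewrite addrAC subrr sub0r normrN gtr0_norm.
  + by rewrite addrAC subrr add0r gtr0_norm.
- move=> x; split=> xq; first by have [-> ->] := pin x xq; rewrite mulr0 add0r mul1r.
  have -> : h' x = 0.
    by move: xq; rewrite ler_normr => /orP[] ?; [apply: (hR _ _).2|apply: (hL _ _).2]; lra.
  rewrite mulr0 addr0 normrM; apply: (@le_trans _ _ (1 * (4 / (4 / k)))).
    by apply: ler_pM.
  by rewrite (_ : 1 * _ = k)//; field; lra.
Qed.

End Splines.

(** * Compactly supported test functions on the plane *)

Section CompactSupport.
Context {R : realType}.
Implicit Types (f g : R * R -> R) (x v : R * R) (A : set (R * R)).

Lemma is_derive_line f x v (d : R) :
  is_derive (0 : R) (1 : R) (fun t : R => f (t *: v + x)) d -> is_derive x v f d.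
Proof.
move=> [/cvg_ex[l Hl] dE].
have E : (fun h : R => h^-1 *: (((fun t : R => f (t *: v + x)) \o shift 0) (h *: 1)
    - f (0 *: v + x))) = (fun h : R => h^-1 *: ((f \o shift x) (h *: v) - f x)).
  by apply/funext => h /=; rewrite addr0 scale0r add0r [h *: 1]mulr1.
split; first by apply/cvg_ex; exists l; rewrite -E.
by rewrite -dE /derive -E.
Qed.

Lemma nbhs_plane_eq0 f x : ~ closure [set y | f y != 0] x ->
  \forall y \near x, f y = 0.
Proof.
move=> nx; have : nbhs x (~` closure [set y | f y != 0]).
  by apply: open_nbhs_nbhs; split => //; apply/closed_openC/closed_closure.
apply: filterS => y ny; apply: contrapT => fy0; apply: ny.
by apply: subset_closure => /=; apply/eqP.
Qed.

Lemma derive_outside_support f x v :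
  ~ closure [set y | f y != 0] x -> 'D_v f x = 0.
Proof.
move=> /nbhs_plane_eq0 f0.
by rewrite (@near_eq_derive _ _ _ f (cst 0) x v f0) derive_cst.
Qed.

Lemma compact_support_bounded (h : R * R -> R) (K : set (R * R)) :
  continuous h -> compact K -> (forall x, ~ K x -> h x = 0) ->
  exists M, forall x, `|h x| <= M.
Proof.
move=> ch cK h0.
have : compact (h @` K).
  by apply: continuous_compact => //; apply: continuous_subspaceT.
move=> /compact_bounded[M [Mr HM]]; exists (Num.max M 0 + 1) => x.
have [Kx|/h0 ->] := pselect (K x); last by rewrite normr0 addr_ge0// le_max lexx orbT.
by apply: HM; [rewrite ltr_pwDr// le_max lexx|exists x].
Qed.

Lemma bounded_measurable_integrable (h : R * R -> R) (M : R) (A : set (mplane R)) :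
  measurable A -> (lebesgue2 R A < +oo)%E ->
  measurable_fun A (h : mplane R -> measurableTypeR R) ->
  (forall x, A x -> `|h x| <= M) ->
  (lebesgue2 R).-integrable A (EFin \o (h : mplane R -> R)).
Proof.
move=> mA Aoo mh hM; apply: measurable_bounded_integrable => //.
exists M; split; first exact: num_real.
by move=> y My x /= Ax; apply: (le_trans (hM x Ax)); exact: ltW.
Qed.

Lemma C1c_integrable f (A : set (mplane R)) :
  C1c f -> measurable A -> (lebesgue2 R A < +oo)%E ->
  (lebesgue2 R).-integrable A (EFin \o ('D_((1, 0) : R * R) f : mplane R -> R)) /\
  (lebesgue2 R).-integrable A (EFin \o ('D_((0, 1) : R * R) f : mplane R -> R)).
Proof.
move=> [cK _ c1 c2] mA Aoo.
have bd v : continuous ('D_v f) ->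
    (lebesgue2 R).-integrable A (EFin \o ('D_v f : mplane R -> R)).
  move=> cD.
  have [M HM] := compact_support_bounded cD cK (fun x => @derive_outside_support f x v).
  apply: (@bounded_measurable_integrable _ M) => //.
  by apply: measurable_funTS; exact: continuous_plane_measurable.
by split; exact: bd.
Qed.

Lemma C1c_scale (c : R) f : C1c f ->
  [/\ C1c (fun x => c * f x),
    forall x, 'D_((1, 0) : R * R) (fun x => c * f x) x = c * 'D_((1, 0) : R * R) f x &
    forall x, 'D_((0, 1) : R * R) (fun x => c * f x) x = c * 'D_((0, 1) : R * R) f x].
Proof.
move=> [cK [d1 d2] c1 c2].
have D v (d : forall x, derivable f x v) :
    (fun x => 'D_v (fun x => c * f x) x) = (fun x => c * 'D_v f x).
  by apply/funext => x; rewrite (_ : (fun x => c * f x) = c \*: f)// deriveZ.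
split; [split|by move=> x; exact: (congr1 (fun h => h x) (D _ d1))|
  by move=> x; exact: (congr1 (fun h => h x) (D _ d2))].
- apply: (subclosed_compact _ cK); first exact: closed_closure.
  apply: closureS => x /=; apply: contra_neq => ->; exact: mulr0.
- by split=> x; exact: derivableZ.
- by rewrite (D _ d1) => x; exact: (cvgM (cvg_cst c) (c1 x)).
- by rewrite (D _ d2) => x; exact: (cvgM (cvg_cst c) (c2 x)).
Qed.

Lemma C1c_add f g : C1c f -> C1c g ->
  [/\ C1c (fun x => f x + g x),
    forall x, 'D_((1, 0) : R * R) (fun x => f x + g x) x =
      'D_((1, 0) : R * R) f x + 'D_((1, 0) : R * R) g x &
    forall x, 'D_((0, 1) : R * R) (fun x => f x + g x) x =
      'D_((0, 1) : R * R) f x + 'D_((0, 1) : R * R) g x].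
Proof.
move=> [cK [d1 d2] c1 c2] [cK' [d1' d2'] c1' c2'].
have D v (d : forall x, derivable f x v) (d' : forall x, derivable g x v) :
    (fun x => 'D_v (fun x => f x + g x) x) = (fun x => 'D_v f x + 'D_v g x).
  by apply/funext => x; rewrite (_ : (fun x => f x + g x) = f + g)// deriveD.
split; [split|by move=> x; exact: (congr1 (fun h => h x) (D _ d1 d1'))|
  by move=> x; exact: (congr1 (fun h => h x) (D _ d2 d2'))].
- apply: (@subclosed_compact _ _ (closure [set x | f x != 0] `|` closure [set x | g x != 0])).
  + exact: closed_closure.
  + exact: compactU.
  + rewrite -closureU; apply: closureS => x /=.
    have [->|] := eqVneq (f x) 0; last by left.
    by rewrite add0r; right.
- by split=> x; exact: derivableD.
- by rewrite (D _ d1 d1') => x; exact: (cvgD (c1 x) (c1' x)).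
- by rewrite (D _ d2 d2') => x; exact: (cvgD (c2 x) (c2' x)).
Qed.

(** Since [w1 != 0], the form and the second coordinate are linear coordinates of the plane; cutting
    off in both gives compact support. *)
Lemma C1c_strip (w1 w2 a b q K : R) (p p' s s' : R -> R) : w1 != 0 ->
  C1_pair p p' -> C1_pair s s' ->
  (forall t, ~~ (a < t < b) -> p t = 0) ->
  (forall t, K <= `|t - q| -> s t = 0) ->
  let f x := p (w1 * x.1 + w2 * x.2) * s x.2 in
  [/\ C1c f,
    forall x, 'D_((1, 0) : R * R) f x = w1 * p' (w1 * x.1 + w2 * x.2) * s x.2 &
    forall x, 'D_((0, 1) : R * R) f x = w2 * p' (w1 * x.1 + w2 * x.2) * s x.2 +
      p (w1 * x.1 + w2 * x.2) * s' x.2].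
Proof.
move=> w10 Cp Cs p0 s0 f.
have D1 x : is_derive x ((1, 0) : R * R) f (w1 * p' (w1 * x.1 + w2 * x.2) * s x.2).
  apply: is_derive_line.
  have [d _] := C1_pair_mul (C1_pair_comp_affine w1 (w1 * x.1 + w2 * x.2) Cp)
    (C1_pair_comp_affine 0 x.2 Cs).
  have := d 0; rewrite !mulr0 !mul0r !add0r mulr0 add0r [s x.2 * _]mulrC.
  congr is_derive; apply/funext => t /=; rewrite /f /=.
  by rewrite !mul0r !add0r [t *: 0]mulr0 add0r [t *: 1]mulr1 mulrDr addrA.
have D2 x : is_derive x ((0, 1) : R * R) f (w2 * p' (w1 * x.1 + w2 * x.2) * s x.2 +
      p (w1 * x.1 + w2 * x.2) * s' x.2).
  apply: is_derive_line.
  have [d _] := C1_pair_mul (C1_pair_comp_affine w2 (w1 * x.1 + w2 * x.2) Cp)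
    (C1_pair_comp_affine 1 x.2 Cs).
  have := d 0; rewrite !mulr0 !add0r mul1r [X in is_derive _ _ _ X]addrC [s x.2 * _]mulrC.
  congr is_derive; apply/funext => t /=; rewrite /f /=.
  by rewrite mul1r [t *: 0]mulr0 add0r [t *: 1]mulr1 mulrDr addrCA.
have E1 : (fun x => 'D_((1, 0) : R * R) f x) =
    (fun x => w1 * p' (w1 * x.1 + w2 * x.2) * s x.2).
  by apply/funext => x; case: (D1 x).
have E2 : (fun x => 'D_((0, 1) : R * R) f x) =
    (fun x => w2 * p' (w1 * x.1 + w2 * x.2) * s x.2 + p (w1 * x.1 + w2 * x.2) * s' x.2).
  by apply/funext => x; case: (D2 x).
have c h h' : C1_pair h h' -> continuous (h : R -> R).
  by move=> [dh _] x; apply/differentiable_continuous/derivable1_diffP; case: (dh x).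
have c2 (h : R -> R) : continuous h -> continuous (fun x : R * R => h x.2).
  by move=> ch x; apply: continuous_comp; [exact: cvg_snd|exact: ch].
have cu (h : R -> R) : continuous h -> continuous (fun x : R * R => h (w1 * x.1 + w2 * x.2)).
  move=> ch x; apply: (@continuous_comp _ _ _ (fun x : R * R => w1 * x.1 + w2 * x.2)); last exact: ch.
  by apply: cvgD; apply: cvgM; [exact: cvg_cst|exact: cvg_fst|exact: cvg_cst|exact: cvg_snd].
split; [split|by move=> x; case: (D1 x)|by move=> x; case: (D2 x)].
(* Bound for the first coordinate: [w1 * x.1] is the level, between [a] and [b], minus
   [w2 * x.2]. *)
- pose N := (`|a| + `|b| + `|w2| * (`|q| + `|K|)) / `|w1|.
  pose B : set (R * R) := `[- N, N]%classic `*` `[q - K, q + K]%classic.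
  have cB : compact B by apply: compact_setX; exact: segment_compact.
  apply: (@subclosed_compact _ _ B) => //; first exact: closed_closure.
  have -> : B = closure B.
    apply/closure_id; rewrite /B -[X in closed X]/(fst @^-1` `[- N, N] `&` snd @^-1` `[q - K, q + K]).
    by apply: closedI; apply: closed_comp; [move=> ? _; exact: cvg_fst|exact: itv_closed|
      move=> ? _; exact: cvg_snd|exact: itv_closed].
  apply: closureS => x /= fx.
  have xK : `|x.2 - q| < K.
    by rewrite ltNge; apply: contra_neqN fx => /s0 sx; rewrite /f sx mulr0.
  have : a < w1 * x.1 + w2 * x.2 < b.
    by apply: contra_neqT fx => /p0 px; rewrite /f px mul0r.
  have x2 : `|x.2| <= `|q| + `|K|.
    rewrite -(subrK q x.2) addrC (le_trans (ler_normD _ _))// lerD2l (le_trans (ltW xK))//.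
    exact: ler_norm.
  move=> /andP[ux1 ux2]; split => /=; rewrite in_itv/=; last by move: xK; rewrite ltr_distl; lra.
  rewrite -ler_norml /N ler_pdivlMr ?normr_gt0// mulrC -normrM.
  have -> : w1 * x.1 = (w1 * x.1 + w2 * x.2) - w2 * x.2 by rewrite addrK.
  rewrite (le_trans (ler_normB _ _))// lerD//; last by rewrite normrM ler_wpM2l.
  rewrite ler_norml; have := ler_norm b; have := ler_norm (- a); rewrite normrN.
  by have := normr_ge0 a; have := normr_ge0 b; lra.
- by split=> x; [case: (D1 x)|case: (D2 x)].
- rewrite E1 => x; apply: cvgM; last exact: (c2 _ (c _ _ Cs) x).
  exact: (cvgM (cvg_cst _) (cu _ Cp.2 x)).
- rewrite E2 => x; apply: cvgD.
    apply: cvgM; last exact: (c2 _ (c _ _ Cs) x).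
    exact: (cvgM (cvg_cst _) (cu _ Cp.2 x)).
  by apply: cvgM; [exact: (cu _ (c _ _ Cp) x)|exact: (c2 _ Cs.2 x)].
Qed.

End CompactSupport.

(** * Flux of test fields over strips of levels of a linear form *)

Section Strip.
Context {R : realType}.

Lemma C1_pair_continuous (f f' : R -> R) : C1_pair f f' -> continuous f.
Proof.
by move=> [df _] x; apply/differentiable_continuous/derivable1_diffP; case: (df x).
Qed.

Lemma C1_pair_integral (f f' : R -> R) (a b : R) : C1_pair f f' -> a < b ->
  (\int[lebesgue_measure]_(x in `[a, b]) (f' x)%:E = (f b - f a)%:E)%E.
Proof.
move=> Cf ab; have [df cf'] := Cf; have cf := C1_pair_continuous Cf.
rewrite (@continuous_FTC2 R f' f a b)//; first exact: continuous_subspaceT.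
- split; first by move=> x _; case: (df x).
    exact/cvg_at_right_filter/cf.
  exact/cvg_at_left_filter/cf.
- by move=> x _; rewrite derive1E; case: (df x).
Qed.

Lemma linear_form_continuous (w1 w2 : R) : continuous (fun x : R * R => w1 * x.1 + w2 * x.2).
Proof.
move=> x; apply: cvgD; apply: cvgM; [exact: cvg_cst|exact: cvg_fst|exact: cvg_cst|exact: cvg_snd].
Qed.

Definition strip_box (w1 w2 a b q d : R) : set (R * R) :=
  [set x | a <= w1 * x.1 + w2 * x.2 <= b /\ `|x.2 - q| <= d].

Lemma measurable_strip_box (w1 w2 a b q d : R) :
  measurable (strip_box w1 w2 a b q d : set (mplane R)).
Proof.
have -> : strip_box w1 w2 a b q d = (fun x : mplane R => w1 * x.1 + w2 * x.2) @^-1` `[a, b]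
    `&` (fun x : mplane R => x.2) @^-1` `[q - d, q + d].
  by apply/seteqP; split => x; rewrite /strip_box /= !in_itv/= ler_distl => -[-> ->].
apply: measurableI; rewrite -[X in measurable X]setTI.
- by apply: (continuous_plane_measurable (@linear_form_continuous w1 w2)) => //.
- by apply: (@measurable_snd _ _ (measurableTypeR R) (measurableTypeR R)) => //.
Qed.

(** Each horizontal slice has length [(b - a) / w1], which cancels the factor [w1]; the fundamental
    theorem of calculus then applies in the second variable. The sign of [s'] gives access to
    Tonelli. *)
Lemma integral_strip_box (w1 w2 a b q d : R) (s s' : R -> R) :
  0 < w1 -> a <= b -> 0 < d -> C1_pair s s' ->
  (forall t, `|t - q| <= d -> 0 <= s' t) ->
  (\int[lebesgue2 R]_(x in strip_box w1 w2 a b q d) (w1 * s' x.2)%:E =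
   ((b - a) * (s (q + d) - s (q - d)))%:E)%E.
Proof.
move=> w10 ab d0 Cs s'0.
set T := strip_box w1 w2 a b q d.
pose g : mplane R -> \bar R := ((fun x : mplane R => (w1 * s' x.2)%:E) \_ T)%E.
have mg : measurable_fun setT g.
  apply/(measurable_restrictT _ (measurable_strip_box w1 w2 a b q d)).
  apply/measurable_EFinP; apply: measurable_funTS; apply: continuous_plane_measurable => x.
  apply: cvgM; first exact: cvg_cst.
  by apply: continuous_comp; [exact: cvg_snd|exact: Cs.2].
have g0 x : (0 <= g x)%E.
  rewrite /g patchE; case: ifPn => // /set_mem[_ xq].
  by rewrite lee_fin mulr_ge0 ?s'0// ltW.
transitivity (\int[lebesgue2 R]_x g x)%E; first exact: integral_mkcond.
transitivity (\int[lebesgue_measure]_y (fubini_G (@lebesgue_measure R) g y))%E.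
  exact: (fubini_tonelli2 g mg g0).
transitivity (\int[@lebesgue_measure R]_(y in `[(q - d)%R, (q + d)%R]) ((b - a) * s' y)%:E)%E; last first.
  have [ds cs'] := Cs.
  rewrite (@C1_pair_integral (fun y => (b - a) * s y)); [by rewrite mulrBr| |lra].
  split=> x; last by apply: cvgM; [exact: cvg_cst|exact: cs'].
  by have := ds x => ?; exact: is_derive_eq.
rewrite [RHS]integral_mkcond; apply: eq_integral => y _.
rewrite /fubini_G patchE; case: ifPn => yI; last first.
  rewrite (_ : (fun x => g (x, y)) = cst 0%E) ?integral0//.
  apply/funext => x; rewrite /g patchE ifF//; apply/negP => /set_mem[_ /= yq].
  by move: yI; rewrite notin_setE/= in_itv/=; move: yq; rewrite ler_distl.
have yq : `|y - q| <= d by move: yI; rewrite inE/= in_itv/= ler_distl.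
pose J := `[(a - w2 * y) / w1, (b - w2 * y) / w1]%classic.
have -> : (fun x => g (x, y)) = (fun x => (w1 * s' y)%:E * (\1_J x)%:E)%E.
  apply/funext => x; rewrite /g patchE indicE.
  have -> : ((x, y) \in T) = (x \in J).
    apply/idP/idP; rewrite !inE /J /T/= in_itv/= ler_pdivrMr// ler_pdivlMr//.
      by case=> /= + _; lra.
    by move=> ?; split=> //=; lra.
  by case: ifPn => _; rewrite ?mule1 ?mule0.
have ws0 : 0 <= w1 * s' y by rewrite mulr_ge0 ?s'0// ltW.
have mJ : measurable (J : set (measurableTypeR R)) by exact: measurable_itv.
have mJ1 : measurable_fun setT (fun x : measurableTypeR R => (\1_J x : R)%:E).
  by apply/measurable_EFinP; exact: measurable_indic.
rewrite ge0_integralZl_EFin//.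
have muJ : @lebesgue_measure R J = ((b - a) / w1)%:E.
  rewrite /J lebesgue_measure_itv/= lte_fin.
  case: ifPn => [_|]; first by rewrite -EFinD; congr EFin; field; lra.
  rewrite -leNgt => ba; have -> : b = a; last by rewrite subrr mul0r.
  by apply/le_anti; rewrite ab andbT; move: ba; rewrite ler_pM2r ?invr_gt0//; lra.
rewrite integral_indic// setIT [X in (_ * X)%E]muJ -EFinM; congr EFin; field; lra.
Qed.

(* The divergence of the field [f * (- w2, w1)]. *)
Definition twist (w1 w2 : R) (f : R * R -> R) : mplane R -> R :=
  fun x => w1 * 'D_((0, 1) : R * R) f x + (- w2) * 'D_((1, 0) : R * R) f x.

Definition flux (A : set (mplane R)) (w1 w2 : R) (f : R * R -> R) : R :=
  \int[lebesgue2 R]_(x in A) twist w1 w2 f x.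

Lemma twist_integrable (A : set (mplane R)) (f : R * R -> R) (w1 w2 : R) :
  C1c f -> measurable A -> (lebesgue2 R A < +oo)%E ->
  (lebesgue2 R).-integrable A (EFin \o twist w1 w2 f).
Proof.
move=> Cf mA Aoo; have [i1 i2] := C1c_integrable Cf mA Aoo.
exact: (integrableD mA (integrableZl mA w1 i2) (integrableZl mA (- w2) i1)).
Qed.

Lemma flux_add (A : set (mplane R)) (f g : R * R -> R) (w1 w2 : R) :
  C1c f -> C1c g -> measurable A -> (lebesgue2 R A < +oo)%E ->
  flux A w1 w2 (fun x => f x + g x) = flux A w1 w2 f + flux A w1 w2 g.
Proof.
move=> Cf Cg mA Aoo.
have [_ D1 D2] := C1c_add Cf Cg.
rewrite /flux -(RintegralD mA (twist_integrable w1 w2 Cf mA Aoo) (twist_integrable w1 w2 Cg mA Aoo)).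
by congr Rintegral; apply/funext => x; rewrite /twist D1 D2 !mulrDr addrACA.
Qed.

(* Fields [f * (- w2, w1)], supported over the levels between [a] and [b] of the
   form [w1 x + w2 y], detect twice the length [b - a] in the perimeter of [A]. *)
Definition spans_strip (A : set (mplane R)) (w1 w2 a b : R) : Prop :=
  forall e, 0 < e -> exists f : R * R -> R, [/\ C1c f, (forall x, `|f x| <= 1),
    (forall x, ~~ (a < w1 * x.1 + w2 * x.2 < b) -> f x = 0) &
    2 * (b - a) - e <= flux A w1 w2 f].

(** The two fields live over disjoint ranges of levels, so their sum keeps the bound 1 while the
    fluxes add up. *)
Lemma spans_strip_cat (A : set (mplane R)) (w1 w2 a b c : R) :
  measurable A -> (lebesgue2 R A < +oo)%E -> a <= b -> b <= c ->
  spans_strip A w1 w2 a b -> spans_strip A w1 w2 b c -> spans_strip A w1 w2 a c.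
Proof.
move=> mA Aoo ab bc Qab Qbc e e0.
have eE : 2 * (c - a) - e = 2 * (b - a) - e / 2 + (2 * (c - b) - e / 2) by lra.
have e20 : 0 < e / 2 by rewrite divr_gt0.
have [f [Cf f1 f0 If]] := Qab _ e20; have [g [Cg g1 g0 Ig]] := Qbc _ e20.
have [Cfg D1 D2] := C1c_add Cf Cg.
exists (fun x => f x + g x); split; first exact: Cfg.
- move=> x.
  have [ub|ub] := leP (w1 * x.1 + w2 * x.2) b.
    by rewrite (g0 x) ?addr0// negb_and -!leNgt ub.
  by rewrite (f0 x) ?add0r// negb_and -!leNgt (ltW ub) orbT.
- move=> x; rewrite negb_and -!leNgt => /orP[] ux.
    by rewrite f0 ?g0 ?addr0// negb_and -!leNgt ?ux// (le_trans ux ab).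
  by rewrite f0 ?g0 ?addr0// negb_and -!leNgt ?ux ?orbT// (le_trans bc ux) orbT.
- move: If Ig; rewrite (flux_add w1 w2 Cf Cg mA Aoo).
  by move: (flux A w1 w2 f) (flux A w1 w2 g) => u v If Ig; rewrite eE; exact: lerD.
Qed.

End Strip.

(** * The perimeter of a connected open set is at least twice its diameter *)

Section Diameter.
Context {R : realType}.

Definition finite_area (A : set (mplane R)) : Prop := (lebesgue2 R A < +oo)%E.

(** Only a ball around [p] is known to lie in [A]; the rest of [A] is controlled by its finite area
    alone. That [eta] does not depend on the strip is what the continuation in [spans_strip_hit]
    needs. *)
Lemma spans_strip_local (A : set (mplane R)) (w1 w2 : R) (p : R * R) :
  open (A : set (R * R)) -> finite_area A -> 0 < w1 -> A p ->
  exists2 eta, 0 < eta & forall a b,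
    w1 * p.1 + w2 * p.2 - eta <= a -> a <= b -> b <= w1 * p.1 + w2 * p.2 + eta ->
    spans_strip A w1 w2 a b.
Proof.
move=> oA Aoo w10 Ap.
have mA : measurable A := open_plane_measurable oA.
have [r r0 rA] : exists2 r : R, 0 < r & ball (p : R * R) r `<=` A.
  by have /nbhs_ballP[r r0 rA] : nbhs (p : R * R) A by [apply: open_nbhs_nbhs]; exists r.
pose n := w1 + `|w2|; have n0 : 0 < n by rewrite ltr_wpDr.
(* In the box below, [|w1 * (x.1 - p.1)| <= eta + |w2| * d <= 2 * eta = w1 * r / 2], which keeps it
   inside the ball. *)
pose d := r * w1 / (4 * n); pose eta := r * w1 / 4.
have d0 : 0 < d by rewrite divr_gt0 ?mulr_gt0.
have eta0 : 0 < eta by rewrite divr_gt0 ?mulr_gt0.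
have nd : n * d = eta by rewrite /d /eta; field; lra.
exists eta => // a b pa ab pb e e0.
pose m := fine (lebesgue2 R A).
have m0 : 0 <= m by rewrite fine_ge0.
(* With this slope the loss [w1 * k * m] over all of [A] is at most [e / 2]; [m + 1] keeps the
   denominator positive. *)
pose k := e / (2 * w1 * (m + 1)).
have k0 : 0 < k by rewrite divr_gt0 ?mulr_gt0//; lra.
have e80 : 0 < e / 8 by rewrite divr_gt0.
have km : w1 * k * m <= e / 2.
  rewrite /k (_ : w1 * _ * m = (e / 2) * (m / (m + 1))); last by field; lra.
  by rewrite ler_piMr// ?ler_pdivrMr; lra.
have [f [f' [Cf f01 f0 f1 _]]] := C1_plateau a b e80.
(* [s] jumps from -1 to 1 in a box inside [A], and its slope elsewhere is at
   most [k]; outside the box the flux is therefore at least [- e / 2]. *)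
have [K [s [s' [Cs s1 s0 [sR sL] s'P]]]] := C1_swing p.2 d0 k0.
have w10' : w1 != 0 by rewrite gt_eqF.
have [CF D1 D2] := C1c_strip w2 w10' Cf Cs f0 s0.
set F := (fun x => _) in CF D1 D2.
(* The field points along the level lines of the form, so the derivative of the cutoff [f]
   cancels. *)
have twE x : twist w1 w2 F x = w1 * f (w1 * x.1 + w2 * x.2) * s' x.2.
  by rewrite /twist D1 D2; ring.
exists F; split; first exact: CF.
- move=> x; rewrite /F normrM; have /andP[? ?] := f01 (w1 * x.1 + w2 * x.2).
  by rewrite ger0_norm//; have := s1 x.2; have := normr_ge0 (s x.2); nra.
- by move=> x /f0 fx; rewrite /F fx mul0r.
have low x : - (w1 * k) <= twist w1 w2 F x.
  rewrite twE; have /andP[f1x f2x] := f01 (w1 * x.1 + w2 * x.2); have [s'1 s'2] := s'P x.2.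
  have [xd|xd] := leP `|x.2 - p.2| d.
    have := s'1 xd; move: (f _) (s' _) f1x f2x => u v u0 u1 v0.
    apply: (@le_trans _ _ 0); first by rewrite oppr_le0 ltW// mulr_gt0.
    by rewrite !mulr_ge0// ltW.
  have := s'2 (ltW xd); rewrite ler_norml; move: (f _) (s' _) f1x f2x => u v u0 u1 /andP[v0 _].
  by rewrite -mulrA -mulrN ler_pM2l//; nra.
have lowI (B : set (mplane R)) : measurable B -> B `<=` A ->
    - (e / 2) <= flux B w1 w2 F.
  move=> mB BA.
  have Boo : finite_area B.
    by apply: le_lt_trans Aoo; apply: le_measure; rewrite ?inE.
  have := le_Rintegral mB _ (twist_integrable w1 w2 CF mB Boo) (fun x _ => low x).
  rewrite Rintegral_cst//.
  have mBm : fine (lebesgue2 R B) <= m.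
    apply: fine_le; [rewrite ge0_fin_numE; [exact: Boo|exact: measure_ge0]|
      rewrite ge0_fin_numE; [exact: Aoo|exact: measure_ge0]|].
    by apply: le_measure; rewrite ?inE.
  have mB0 : 0 <= fine (lebesgue2 R B) by rewrite fine_ge0.
  rewrite -/(flux B w1 w2 F).
  move: (fine _) mBm mB0 (flux B w1 w2 F) => v vm v0 u uv.
  have /uv : (lebesgue2 R).-integrable B (EFin \o (fun=> - (w1 * k))).
    by apply: (@bounded_measurable_integrable _ _ `|w1 * k|) => // x _; rewrite normrN.
  apply: le_trans; rewrite mulNr lerN2 (le_trans _ km)// ler_wpM2l//.
  by apply/ltW/mulr_gt0.
(* If [b - a < e / 4], the required bound [2 * (b - a) - e] is already below [- (e / 2)]. *)
have [ab8|ab8] := ltP (b - e / 8) (a + e / 8).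
  by apply: le_trans (lowI A mA _); [lra|].
pose T : set (mplane R) := strip_box w1 w2 (a + e / 8) (b - e / 8) p.2 d.
have mT : measurable T by exact: measurable_strip_box.
have TA : T `<=` A.
  move=> x [/andP[xa xb] xd]; apply: rA; split; rewrite /ball/= distrC; last first.
    apply: (le_lt_trans xd); rewrite /d ltr_pdivrMr ?mulr_gt0// ltr_pM2l// /n.
    by have := normr_ge0 w2; lra.
  rewrite -(ltr_pM2l w10) -{1}(gtr0_norm w10) -normrM mulrBr.
  rewrite (_ : _ - _ = (w1 * x.1 + w2 * x.2 - (w1 * p.1 + w2 * p.2)) - w2 * (x.2 - p.2)); last by ring.
  apply: (le_lt_trans (ler_normB _ _)).
  have xd' : `|w2 * (x.2 - p.2)| <= eta.
    rewrite normrM -nd ler_pM//; rewrite /n; lra.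
  have ux : `|w1 * x.1 + w2 * x.2 - (w1 * p.1 + w2 * p.2)| <= eta.
    by rewrite ler_distl; lra.
  apply: (le_lt_trans (lerD ux xd')).
  by rewrite (_ : eta + eta = w1 * r / 2); [have := mulr_gt0 w10 r0; lra|rewrite /eta; field].
have TAE : A = T `|` (A `\` T) by rewrite setDUK.
have fluxE : flux A w1 w2 F = flux T w1 w2 F + flux (A `\` T) w1 w2 F.
  rewrite /flux {1}TAE Rintegral_setU//; first exact: measurableD.
  - by rewrite -TAE; exact: (twist_integrable _ _ CF mA Aoo).
  - by apply/disj_setPS => x [Tx []].
(* Losing [e / 8] at each end costs [e / 2] under a jump of 2; the complement of the box accounts
   for the other [e / 2]. *)
have fluxT : flux T w1 w2 F = 2 * (b - a - e / 4).
  have := integral_strip_box w2 w10 ab8 d0 Cs (fun t => (s'P t).1).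
  rewrite sR sL => TI.
  rewrite /flux /Rintegral (_ : 2 * _ = fine ((b - e / 8 - (a + e / 8)) * (1 - (-1)))%:E); last by rewrite /=; lra.
  rewrite -TI; congr fine; apply: eq_integral => x /set_mem[ux _]; congr EFin.
  by rewrite twE (f1 _ _).1 ?mulr1.
have := lowI (A `\` T) (measurableD mA mT) (@subDsetl _ _ _).
rewrite fluxE fluxT.
move: (flux _ _ _ _) => v; lra.
Qed.

(** Induction along the levels: around the supremum of the right ends reached so far, the local
    lemma adds a strip that starts before it and ends after it, unless the supremum is [b]. *)
Lemma spans_strip_hit (A : set (mplane R)) (w1 w2 a b : R) :
  open (A : set (R * R)) -> finite_area A -> 0 < w1 -> a <= b ->
  (forall t, a <= t <= b -> exists2 p : R * R, A p & w1 * p.1 + w2 * p.2 = t) ->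
  spans_strip A w1 w2 a b.
Proof.
move=> oA Aoo w10 ab hit; have mA : measurable A := open_plane_measurable oA.
pose S := [set t | a <= t <= b /\ spans_strip A w1 w2 a t].
have Sa : S a.
  split; first by rewrite lexx.
  have [|p Ap pa] := hit a; first by rewrite lexx.
  have [eta eta0 loc] := spans_strip_local w2 oA Aoo w10 Ap.
  by apply: loc; rewrite ?pa ?lexx//; lra.
have ubS : ubound S b by move=> t [/andP[]].
have hS : has_sup S by split; [exists a|exists b].
have sb : sup S <= b by apply: ge_sup => //; exists a.
have sa : a <= sup S by apply: ub_le_sup => //; exists b.
have [|p Ap ps] := hit (sup S); first by rewrite sa.
have [eta eta0 loc] := spans_strip_local w2 oA Aoo w10 Ap.
have [t [/andP[ta tb] Qt] ts] := sup_adherent eta0 hS.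
have tS : t <= sup S by apply: ub_le_sup; [exists b|split; rewrite ?ta].
have tc : t <= Num.min b (sup S + eta) by rewrite le_min tb/=; lra.
have Qc : spans_strip A w1 w2 a (Num.min b (sup S + eta)).
  apply: (spans_strip_cat mA Aoo ta tc Qt); apply: loc => //; rewrite ps.
    exact: ltW.
  by rewrite ge_min lexx orbT.
have cS : Num.min b (sup S + eta) <= sup S.
  apply: ub_le_sup; first by exists b.
  by split => //; rewrite (le_trans ta tc) ge_min lexx.
move: Qc; rewrite min_l//; move: cS; rewrite ge_min => /orP[]; lra.
Qed.

Lemma enormE (x y : R * R) : enorm (x - y) = Num.sqrt ((y.1 - x.1) ^+ 2 + (y.2 - x.2) ^+ 2).
Proof. by rewrite /enorm /= -sqrrN opprB -[(x.2 - _) ^+ 2]sqrrN opprB. Qed.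

Lemma enormC (x y : R * R) : enorm (x - y) = enorm (y - x).
Proof. by rewrite enormE. Qed.

(** Division by the length [n] of [(- w2, w1)] makes the test field admissible. *)
Lemma perimeter_ge_flux (A : set (mplane R)) (w1 w2 n : R) (f : R * R -> R) :
  measurable A -> finite_area A -> 0 < n -> n ^+ 2 = w1 ^+ 2 + w2 ^+ 2 ->
  C1c f -> (forall x, `|f x| <= 1) ->
  ((n^-1 * flux A w1 w2 f)%:E <= perimeter A)%E.
Proof.
move=> mA Aoo n0 nE Cf f1.
have [C1 D11 D12] := C1c_scale (- w2 / n) Cf; have [C2 D21 D22] := C1c_scale (w1 / n) Cf.
apply: ereal_sup_ubound; exists (fun x => - w2 / n * f x), (fun x => w1 / n * f x).
split => [||x|]; [exact: C1|exact: C2| |].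
  rewrite /enorm/= !exprMn -mulrDl sqrrN -!mulrDl addrC -nE exprVn mulfV ?expf_neq0 ?gt_eqF//.
  by rewrite mul1r sqrtr_sqr.
have it := twist_integrable w1 w2 Cf mA Aoo.
transitivity (\int[lebesgue2 R]_(x in A) (n^-1%:E * (twist w1 w2 f x)%:E))%E; last first.
  apply: eq_integral => x _; rewrite /divergence D11 D22 /twist -EFinM; congr EFin; ring.
transitivity (n^-1%:E * \int[lebesgue2 R]_(x in A) (twist w1 w2 f x)%:E)%E; last first.
  exact/esym/(integralZl mA it).
by rewrite EFinM /flux /Rintegral fineK//; exact: integrable_fin_num.
Qed.

(** For the scalar product with [y - x] the levels from [x] to [y] span a length [n ^+ 2], and
    normalizing the field by [n] leaves [2 * n]. Connectedness puts a point of [A] on each of these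
    levels. *)
Lemma perimeter_diameter_lt (A : set (mplane R)) (x y : R * R) :
  open (A : set (R * R)) -> connected (A : set (R * R)) -> finite_area A ->
  A x -> A y -> x.1 < y.1 -> ((2 * enorm (x - y))%:E <= perimeter A)%E.
Proof.
move=> oA cA Aoo Ax Ay xy; have mA : measurable A := open_plane_measurable oA.
set n := enorm (x - y).
have n2E : n ^+ 2 = (y.1 - x.1) ^+ 2 + (y.2 - x.2) ^+ 2.
  by rewrite /n enormE sqr_sqrtr// addr_ge0 ?sqr_ge0.
have n0 : 0 < n.
  by rewrite /n enormE sqrtr_gt0 ltr_pwDl ?sqr_ge0// exprn_gt0// subr_gt0.
have w10 : 0 < y.1 - x.1 by rewrite subr_gt0.
pose u (p : R * R) := (y.1 - x.1) * p.1 + (y.2 - x.2) * p.2.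
have uE : u y - u x = n ^+ 2 by rewrite n2E /u; ring.
have uxy : u x <= u y by rewrite -subr_ge0 uE sqr_ge0.
have hit t : u x <= t <= u y -> exists2 p : R * R, A p & u p = t.
  move=> txy; have : connected (u @` A).
    apply: connected_continuous_connected => //.
    by apply: continuous_subspaceT; exact: linear_form_continuous.
  move=> /connected_intervalP/(_ (u x) (u y)).
  case/(_ (ex_intro2 _ _ x Ax erefl) (ex_intro2 _ _ y Ay erefl) t txy) => p Ap pt.
  by exists p.
have Q := spans_strip_hit oA Aoo w10 uxy hit.
apply/lee_addgt0Pr => e e0.
have en0 : 0 < e * n by rewrite mulr_gt0.
have [f [Cf f1 _ fl]] := Q _ en0.
have := perimeter_ge_flux mA Aoo n0 n2E Cf f1.
rewrite -leeBlDr// => /(le_trans _) => -> //.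
rewrite -EFinB lee_fin ler_pdivlMl//; apply: le_trans fl; rewrite uE.
by rewrite le_eqVlt; apply/orP; left; apply/eqP; ring.
Qed.

Lemma perimeter_diameter (A : set (mplane R)) (x y : R * R) :
  open (A : set (R * R)) -> connected (A : set (R * R)) -> finite_area A ->
  A x -> A y -> ((2 * enorm (x - y))%:E <= perimeter A)%E.
Proof.
move=> oA cA Aoo Ax Ay; have [xy|yx|xy] := ltgtP x.1 y.1.
- exact: perimeter_diameter_lt.
- by rewrite enormC; exact: perimeter_diameter_lt.
have [r r0 rA] : exists2 r : R, 0 < r & ball (y : R * R) r `<=` A.
  by have /nbhs_ballP[r r0 rA] : nbhs (y : R * R) A by [apply: open_nbhs_nbhs]; exists r.
(* For a vertical chord, openness allows [y] to move to the right, which only increases the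
   distance. *)
pose z : R * R := (y.1 + r / 2, y.2).
have Az : A z.
  apply: rA; split; rewrite /ball/= ?subrr ?normr0//.
  by rewrite opprD addNKr normrN gtr0_norm ?divr_gt0//; lra.
have xz : x.1 < z.1 by rewrite /z/= xy ltrDl divr_gt0.
apply: le_trans (perimeter_diameter_lt oA cA Aoo Ax Az xz).
rewrite lee_fin ler_pM2l// !enormE/= xy subrr expr0n/= add0r ler_wsqrtr//.
by rewrite lerDr sqr_ge0.
Qed.

End Diameter.

(* A copy of [lebesgue2 R] that carries a canonical sigma-finite structure. *)
Definition plane_measure {R : realType} : set (mplane R) -> \bar R := lebesgue2 R.

HB.instance Definition _ (R : realType) :=
  Measure.copy (@plane_measure R) (lebesgue2 R).

Lemma plane_measure_sigma_finite {R : realType} :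
  sigma_finite setT (@plane_measure R).
Proof.
pose I n : set (measurableTypeR R) := `]- (n%:R : R), n%:R[%classic.
exists (fun n => I n `*` I n).
  apply/esym; rewrite -subTset => -[x1 x2] _.
  have [a b] : `|x1 : R| <= Num.max `|x1 : R| `|x2 : R| /\ `|x2 : R| <= Num.max `|x1 : R| `|x2 : R|.
    by rewrite !le_max !lexx orbT.
  have := archi_boundP (le_trans (normr_ge0 _) a); set n := Num.bound _ => nE.
  exists n => //; have := le_lt_trans a nE; have := le_lt_trans b nE.
  by rewrite !ltr_norml /I => ? ?; split; rewrite /= in_itv.
move=> n; have mI : measurable (I n) by exact: measurable_itv.
split; first exact: measurableX.
have II : (@plane_measure R (I n `*` I n) = @lebesgue_measure R (I n) * @lebesgue_measure R (I n))%E.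
  exact: product_measure1E.
rewrite II /I lebesgue_measure_itv/=; case: ifPn => _; last by rewrite mule0.
by rewrite -EFinB -EFinM ltry.
Qed.

HB.instance Definition _ (R : realType) :=
  @Measure_isSigmaFinite.Build _ _ _ (@plane_measure R) (@plane_measure_sigma_finite R).

(** * Lower bound of the logarithmic energy by the essential diameter *)

Section LogEnergyBelow.
Context {R : realType}.
Local Notation mu := (@plane_measure R).

Lemma measurable_enorm_sub : measurable_fun (setT : set (mplane R * mplane R))
  (fun z => enorm (z.1 - z.2 : R * R)).
Proof.
apply: (measurableT_comp (f := @Num.sqrt R)).
  by apply: continuous_measurable_fun; exact: sqrt_continuous.
have m11 : measurable_fun setT (fun z : mplane R * mplane R => z.1.1).
  exact: (measurableT_comp (measurable_fst (T1 := measurableTypeR R)) measurable_fst).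
have m12 : measurable_fun setT (fun z : mplane R * mplane R => z.1.2).
  exact: (measurableT_comp (measurable_snd (T1 := measurableTypeR R)) measurable_fst).
have m21 : measurable_fun setT (fun z : mplane R * mplane R => z.2.1).
  exact: (measurableT_comp (measurable_fst (T1 := measurableTypeR R)) measurable_snd).
have m22 : measurable_fun setT (fun z : mplane R * mplane R => z.2.2).
  exact: (measurableT_comp (measurable_snd (T1 := measurableTypeR R)) measurable_snd).
by apply: measurable_funD; apply: measurable_funX; exact: measurable_funB.
Qed.

Lemma measurable_log_kernel : measurable_fun (setT : set (mplane R * mplane R))
  (fun z => (ln (enorm (z.1 - z.2 : R * R))^-1 : R)).
Proof.
have -> : (fun z : mplane R * mplane R => (ln (enorm (z.1 - z.2 : R * R))^-1 : R)) =
    (fun z => - ln (enorm (z.1 - z.2 : R * R))).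
  apply/funext => z; have := sqrtr_ge0 ((z.1.1 - z.2.1) ^+ 2 + (z.1.2 - z.2.2) ^+ 2).
  rewrite /enorm/= le_eqVlt => /orP[/eqP <-|]; first by rewrite invr0 ln0// oppr0.
  by move=> n0; rewrite lnV// posrE.
apply: measurable_funN; apply: measurableT_comp; first exact: measurable_ln.
exact: measurable_enorm_sub.
Qed.

Definition log_potential (E : set (mplane R)) (x : mplane R) : \bar R :=
  (\int[lebesgue2 R]_(y in E) (ln (enorm (x - y : R * R))^-1)%:E)%E.

(** The kernel changes sign and no integrability is at hand, so Tonelli is applied to its positive
    and negative parts separately. *)
Lemma measurable_log_potential (E : set (mplane R)) : measurable E ->
  measurable_fun setT (log_potential E).
Proof.
move=> mE.
pose f (z : mplane R * mplane R) := (ln (enorm (z.1 - z.2 : R * R))^-1)%:E : \bar R.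
have mf : measurable_fun setT f by apply/measurable_EFinP; exact: measurable_log_kernel.
have mEE : measurable ([set: mplane R] `*` E) by exact: measurableX.
have part (g : mplane R * mplane R -> \bar R) : measurable_fun setT g ->
    (forall z, 0 <= g z)%E ->
    measurable_fun setT (fun x : mplane R => \int[mu]_(y in E) g (x, y))%E.
  move=> mg g0.
  have mr : measurable_fun setT (g \_ ([set: mplane R] `*` E)).
    by apply/(measurable_restrictT _ mEE); exact: measurable_funTS.
  have -> : (fun x : mplane R => \int[mu]_(y in E) g (x, y))%E =
      (fun x => \int[mu]_y (g \_ ([set: mplane R] `*` E)) (x, y))%E.
    apply/funext => x; rewrite integral_mkcond; apply: eq_integral => y _.
    by rewrite !patchE in_setX in_setT.
  apply: (measurable_fun_fubini_tonelli_F (m2 := mu) _ mr) => z.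
  by rewrite patchE; case: ifPn.
have -> : log_potential E = (fun x => \int[mu]_(y in E) (f^\+ (x, y)) -
    \int[mu]_(y in E) (f^\- (x, y)))%E.
  apply/funext => x; transitivity (\int[mu]_(y in E) f (x, y))%E; first by [].
  rewrite [LHS]integralE; congr (_ - _)%E; apply: eq_integral => y _.
    by rewrite !funeposE.
  by rewrite !funenegE.
by apply: emeasurable_funB; apply: part => //; [exact: measurable_funepos|exact: measurable_funeneg].
Qed.

(** Only the negative part has to be bounded, so the integral of [f] may be [+oo]. *)
Lemma integral_ge_ae (D : set (mplane R)) (f : mplane R -> \bar R) (K : R) :
  measurable D -> measurable_fun D f -> 0 <= K ->
  (\forall x \ae mu, D x -> ((- K)%:E <= f x)%E) ->
  ((- K)%:E * mu D <= \int[mu]_(x in D) f x)%E.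
Proof.
move=> mD mf K0 Kf.
have fneg : (\int[mu]_(x in D) f^\- x <= K%:E * mu D)%E.
  rewrite -integral_cst//; apply: ae_ge0_le_integral => //; first exact: measurable_funeneg.
  apply: filterS Kf => x fx Dx; rewrite /cst funenegE ge_max lee_fin K0 andbT.
  by rewrite leeNl; exact: fx.
have fpos : (0 <= \int[mu]_(x in D) f^\+ x)%E by exact: integral_ge0.
rewrite integralE EFinN mulNe; apply: (@le_trans _ _ (0 - \int[mu]_(x in D) f^\- x)%E).
  by rewrite sub0e leeN2.
exact: leeB.
Qed.

(** [E] is reached only through sets close to it in L^1, so the diameter bound is put on sets that
    miss arbitrarily little of [E]; they may stick out of [E]. *)
Definition almost_within (E : set (mplane R)) (D : R) : Prop :=
  forall d, 0 < d -> exists A : set (mplane R), [/\ measurable A,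
    (mu (E `\` A) <= d%:E)%E &
    forall x y : mplane R, A x -> A y -> enorm (x - y : R * R) <= D].

Lemma measurable_far (D : R) :
  measurable [set z : mplane R * mplane R | D < enorm (z.1 - z.2 : R * R)].
Proof.
rewrite -[X in measurable X]setTI (_ : [set z | _] =
  (fun z : mplane R * mplane R => enorm (z.1 - z.2 : R * R)) @^-1` `]D, +oo[%classic); last first.
  by apply/seteqP; split => z /=; rewrite in_itv/= andbT.
have mi : measurable_fun setT (fun z : mplane R * mplane R => enorm (z.1 - z.2 : R * R)).
  exact: measurable_enorm_sub.
by apply: mi => //; exact: measurable_itv.
Qed.

Lemma small_product_bound (m e : R) : 0 <= m -> 0 <= e ->
  e / (2 * (m + 1)) * m + m * (e / (2 * (m + 1))) <= e.
Proof.
move=> m0 e0; rewrite (_ : _ + _ = e * (m / (m + 1))); last by field; lra.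
by rewrite ler_piMr// ler_pdivrMr; lra.
Qed.

(* The set of far pairs is covered by [(E \ A) * E] and [E * (E \ A)], so its
   product measure vanishes. *)
Lemma almost_within_ae (E : set (mplane R)) (D m : R) :
  measurable E -> mu E = m%:E -> almost_within E D ->
  \forall x \ae mu, E x ->
    \forall y \ae mu, E y -> enorm (x - y : R * R) <= D.
Proof.
move=> mE Em wE.
have m0 : 0 <= m by rewrite -lee_fin -Em measure_ge0.
pose Z := [set z : mplane R * mplane R | D < enorm (z.1 - z.2 : R * R)] `&` (E `*` E).
have mZ : measurable Z by apply: measurableI; [exact: measurable_far|exact: measurableX].
have Z0 : ((mu \x mu) Z = 0)%E.
  apply/le_anti; rewrite measure_ge0 andbT; apply/lee_addgt0Pr => e e0; rewrite add0e.
  have d0 : 0 < e / (2 * (m + 1)) by rewrite divr_gt0 ?mulr_gt0// ltr_wpDl.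
  have de := small_product_bound m0 (ltW e0).
  have [A [mA EA AD]] := wE _ d0.
  have mEA : measurable (E `\` A) by exact: measurableD.
  apply: (@le_trans _ _ ((mu \x mu) (((E `\` A) `*` E) `|` (E `*` (E `\` A))))%E).
    apply: le_measure; rewrite ?inE//.
      by apply: measurableU; exact: measurableX.
    move=> [x y] [/= Dxy [/= Ex Ey]].
    have [Ax|nAx] := pselect (A x); last by left.
    have [Ay|nAy] := pselect (A y); last by right.
    by move: (AD _ _ Ax Ay); rewrite leNgt Dxy.
  apply: (le_trans (measureU2 _ _ _)); [exact: measurableX|exact: measurableX|].
  have P1 : ((mu \x mu) ((E `\` A) `*` E) <= (e / (2 * (m + 1)))%:E * m%:E)%E.
    have -> : ((mu \x mu) ((E `\` A) `*` E) = mu (E `\` A) * mu E)%E by exact: product_measure1E.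
    by rewrite Em; apply: lee_wpmul2r.
  have P2 : ((mu \x mu) (E `*` (E `\` A)) <= m%:E * (e / (2 * (m + 1)))%:E)%E.
    have -> : ((mu \x mu) (E `*` (E `\` A)) = mu E * mu (E `\` A))%E by exact: product_measure1E.
    by rewrite Em; apply: lee_wpmul2l.
  apply: (le_trans (leeD P1 P2)).
  rewrite -!EFinM -EFinD lee_fin.
  exact: de.
have mx := measurable_fun_xsection mu mZ.
have : ae_eq mu setT (fun x => mu (xsection Z x)) (cst 0%E).
  apply/ae_eq_integral_abs => //.
  rewrite -[RHS]Z0; apply: eq_integral => x _.
  by rewrite gee0_abs// measure_ge0.
apply: filterS => x /(_ I) /= Zx Ex.
exists (xsection Z x); split; [exact: measurable_xsection|exact: Zx|].
move=> y /= /not_implyP[Ey /negP]; rewrite -ltNge => Dxy.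
by rewrite /xsection/= inE; split.
Qed.

(** The pointwise bound [- ln D] is integrated twice. [1 <= D] makes [ln D] nonnegative, as
    [integral_ge_ae] requires, and covers the diagonal, where the kernel has the default value 0. *)
Lemma log_energy_ge (E : set (mplane R)) (D m : R) :
  measurable E -> mu E = m%:E -> 1 <= D -> almost_within E D ->
  ((- (m ^+ 2 * ln D))%:E <= log_energy E)%E.
Proof.
move=> mE Em D1 wE.
have m0 : 0 <= m by rewrite -lee_fin -Em measure_ge0.
have lD : 0 <= ln D by exact: ln_ge0.
have mlp := measurable_log_potential mE.
have -> : - (m ^+ 2 * ln D) = - (m * ln D) * m by ring.
have := @integral_ge_ae E (log_potential E) (m * ln D) mE (measurable_funTS mlp) _ _.
rewrite Em -EFinM; apply; first exact: mulr_ge0.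
apply: filterS (almost_within_ae mE Em wE) => x /[apply] xE.
have -> : - (m * ln D) = - ln D * m by ring.
rewrite EFinM -Em; apply: integral_ge_ae => //.
  apply: measurable_funTS; apply/measurable_EFinP.
  exact: (measurableT_comp measurable_log_kernel (measurable_pair1 x)).
apply: filterS xE => y /[apply] xyD.
rewrite lee_fin lerNl; have := sqrtr_ge0 ((x - y : R * R).1 ^+ 2 + (x - y : R * R).2 ^+ 2).
rewrite -/(enorm (x - y : R * R)) le_eqVlt => /orP[/eqP <-|n0].
  by rewrite invr0 ln0// oppr0.
by rewrite lnV ?posrE// opprK ler_ln// posrE; lra.
Qed.

End LogEnergyBelow.

(** * From approximating sequences to the lower bound of the energy *)

Section EnergyBelow.
Context {R : realType}.
Local Notation mu := (@plane_measure R).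
Implicit Types (A E : set (mplane R)).

(** A point of [A] outside the interior is a boundary point. There the chart is a strict inequality
    between functions continuous at that point, so it persists nearby. *)
Lemma smooth_set_open (A : set (R * R)) : smooth_set A -> open A.
Proof.
move=> sA; rewrite openE => x Ax; apply: contrapT => nx.
have bx : boundary A x.
  split; first exact: subset_closure.
  move=> B nB; apply: contrapT => H; apply: nx; apply: filterS nB => y By.
  by apply: contrapT => nA; apply: H; exists y.
have [r [h [r0 H]]] := sA x bx; apply: nx.
have pos (F : R * R -> R) : F y @[y --> x] --> F x -> 0 < F x ->
    (forall y, ball x r y -> 0 < F y -> A y) -> nbhs x A.
  move=> cF Fx FA; have F0 : \forall y \near x, 0 < F y by exact: (cvgr_gt (F x) cF).
  by apply: filterS2 F0 (nbhsx_ballx x r r0) => y Fy /FA; exact.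
have xx : ball x r x by exact: ballxx.
have ch t : (forall n s, `|s - t| < r -> derivable (derive1n n h) s 1) ->
    {for t, continuous h}.
  move=> /(_ 0%N t); rewrite subrr normr0 => /(_ r0).
  by move=> /derivable1_diffP/differentiable_continuous.
have c1 : {for x.1, continuous h} -> h y.1 @[y --> x] --> h x.1.
  by move=> c; apply: (@continuous_comp _ _ _ (@fst R R)); [exact: cvg_fst|exact: c].
have c2 : {for x.2, continuous h} -> h y.2 @[y --> x] --> h x.2.
  by move=> c; apply: (@continuous_comp _ _ _ (@snd R R)); [exact: cvg_snd|exact: c].
have f1 : y.1 @[y --> x] --> x.1 by exact: cvg_fst.
have f2 : y.2 @[y --> x] --> x.2 by exact: cvg_snd.
case: H => -[/ch dh [] HA].
- apply: (pos (fun y => y.2 - h y.1)); first exact: (cvgB f2 (c1 dh)).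
    by rewrite subr_gt0; apply/(HA x xx).
  by move=> y yr; rewrite subr_gt0 => /(HA y yr).
- apply: (pos (fun y => h y.1 - y.2)); first exact: (cvgB (c1 dh) f2).
    by rewrite subr_gt0; apply/(HA x xx).
  by move=> y yr; rewrite subr_gt0 => /(HA y yr).
- apply: (pos (fun y => y.1 - h y.2)); first exact: (cvgB f1 (c2 dh)).
    by rewrite subr_gt0; apply/(HA x xx).
  by move=> y yr; rewrite subr_gt0 => /(HA y yr).
- apply: (pos (fun y => h y.2 - y.1)); first exact: (cvgB (c2 dh) f1).
    by rewrite subr_gt0; apply/(HA x xx).
  by move=> y yr; rewrite subr_gt0 => /(HA y yr).
Qed.

Lemma limn_einf_lt_frequently (u : nat -> \bar R) (q : \bar R) (N : nat) :
  (limn_einf u < q)%E -> exists2 n, (N <= n)%N & (u n < q)%E.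
Proof.
move=> uq.
have : (einfs u N < q)%E.
  apply: le_lt_trans uq; rewrite limn_einf_lim (cvg_lim _ (@cvg_einfs_sup _ u))//.
  by apply: ereal_sup_ubound; exists N.
by move=> /ereal_inf_lt[_ [n Nn <-] uq']; exists n.
Qed.

Lemma measure_le_indic_dist A E B : measurable A -> measurable E -> measurable B ->
  (forall x, B x -> A x <> E x) ->
  (mu B <= \int[lebesgue2 R]_x `|(\1_A x : R) - \1_E x|%:E)%E.
Proof.
move=> mA mE mB BAE.
apply: (@le_trans _ _ (\int[lebesgue2 R]_x (\1_B x : R)%:E)%E).
  have -> : (\int[lebesgue2 R]_x (\1_B x : R)%:E = lebesgue2 R (B `&` setT))%E by exact: integral_indic.
  by rewrite setIT.
apply: ge0_le_integral => //.
- by apply/measurable_EFinP; exact: measurable_indic.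
- apply/measurable_EFinP; apply: measurableT_comp => //.
  by apply: measurable_funB; exact: measurable_indic.
- move=> x _; rewrite lee_fin !indicE.
  case: (boolP (x \in B)) => [/set_mem Bx|_]; last by rewrite normr_ge0.
  have := BAE x Bx.
  case: (boolP (x \in A)) => [/set_mem|/negP]; rewrite ?inE => Ax;
  case: (boolP (x \in E)) => [/set_mem|/negP]; rewrite ?inE => Ex; rewrite ?subr0 ?sub0r ?normrN ?normr1//.
    by case; apply/propext; split.
  by case; apply/propext; split.
Qed.

(** A lower limit below [q] gives perimeters below [q] at arbitrarily late indices, so some index
    also has a set close to [E]. That closeness supplies the finite area for [perimeter_diameter] as
    well. *)
Lemma relaxed_perimeter_almost_within (C : set (set (R * R))) E (m q : R) :
  (forall A, C A -> connected A /\ smooth_set A) ->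
  measurable E -> mu E = m%:E -> (relaxed_perimeter C E < q%:E)%E ->
  almost_within E (q / 2).
Proof.
move=> Cc mE Em /ereal_inf_lt[_ [En [CEn cEn ->]] lq] d d0.
have dd : (0 < d%:E :> \bar R)%E by rewrite lte_fin.
have nb : nbhs (0%E : \bar R) [set y : \bar R | (y < d%:E)%E].
  by apply: open_nbhs_nbhs; split; [exact: open_ereal_lt_ereal|].
have [N _ HN] := cEn _ nb.
have [n Nn Pn] := limn_einf_lt_frequently N lq.
have Dn := HN n Nn; have [cn /smooth_set_open on] := Cc _ (CEn n).
have mn : measurable (En n : set (mplane R)) := open_plane_measurable on.
exists (En n); split; first exact: mn.
- apply: le_trans (ltW Dn); apply: measure_le_indic_dist => //; first exact: measurableD.
  by move=> x [Ex nx] EE; apply: nx; rewrite EE.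
- have fn : finite_area (En n).
    have mD : measurable (En n `\` E) by exact: measurableD.
    have : (mu (En n) <= mu E + mu (En n `\` E))%E.
      apply: le_trans (measureU2 _ mE mD); apply: le_measure; rewrite ?inE//.
        exact: measurableU.
      by move=> x nx; have [Ex|Ex] := pselect (E x); [left|right].
    move=> /le_lt_trans; apply; rewrite Em lte_add_pinfty// ?ltry//.
    apply: (@lt_trans _ _ d%:E); last exact: ltry.
    apply: le_lt_trans Dn; apply: measure_le_indic_dist => //.
    by move=> x [nx Ex] EE; apply: Ex; rewrite -EE.
  move=> x y Ax Ay; rewrite ler_pdivlMr// mulrC -lee_fin.
  exact: le_trans (perimeter_diameter on cn fn Ax Ay) (ltW Pn).
Qed.

(** With tolerance [m / 2] the set [A] cannot be empty, and [D] bounds the distance of a point to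
    itself. *)
Lemma almost_within_ge0 E (D m : R) : measurable E -> mu E = m%:E -> 0 < m ->
  almost_within E D -> 0 <= D.
Proof.
move=> mE Em m0 wE; have m20 : 0 < m / 2 by rewrite divr_gt0.
have mm : m / 2 < m by lra.
have [A [mA EA AD]] := wE _ m20.
have [A0|/set0P[x Ax]] := eqVneq A set0.
  by move: EA; rewrite A0 setD0 Em lee_fin leNgt mm.
by apply: le_trans (AD x x Ax Ax); exact: sqrtr_ge0.
Qed.

(** This is [ln z <= z - 1] at [z = q / c], multiplied by [c]. *)
Lemma sub_mul_ln_ge (c q : R) : 0 < c -> 0 < q ->
  c - c * ln (c / 2) <= q - c * ln (q / 2).
Proof.
move=> c0 q0.
have : ln (q / c) <= q / c - 1.
  have -> : q / c = 1 + (q / c - 1) by ring.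
  rewrite (le_trans (le_ln1Dx _))//; last by rewrite addrAC subrr add0r.
  by rewrite ltrBrDl subrr divr_gt0.
have -> : q / c = (q / 2) / (c / 2) by field; lra.
rewrite ln_div ?posrE ?divr_gt0// -(ler_pM2l c0).
have -> : c * (q / 2 / (c / 2) - 1) = q - c by field; lra.
lra.
Qed.

(** The choice [q = r + 1], strictly above the relaxed perimeter [r], costs the constant 1. The
    threshold [2 * expR 1] makes [c - c * ln (c / 2)] nonpositive; this settles the case
    [q / 2 <= 1], where [D = 1] and only [r >= -1] is known. *)
Lemma energy_ge (C : set (set (R * R))) (lam : R) E :
  (forall A, C A -> connected A /\ smooth_set A) ->
  measurable E -> mu E = pi%:E -> 0 < lam -> 2 * expR 1 <= pi ^+ 2 * lam ->
  ((pi ^+ 2 * lam - pi ^+ 2 * lam * ln (pi ^+ 2 * lam / 2) - 1)%:E <= energy C lam E)%E.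
Proof.
move=> Cc mE Em lam0 cbig; set c := pi ^+ 2 * lam in cbig *.
have c0 : 0 < c by rewrite mulr_gt0 ?exprn_gt0 ?pi_gt0.
have low : c - c * ln (c / 2) <= 0.
  have : 1 <= ln (c / 2).
    by rewrite -[leLHS]expRK ler_ln ?posrE ?expR_gt0 ?divr_gt0// ler_pdivlMr// mulrC.
  nra.
rewrite /energy; case: ifPn => [_|Coo]; first exact: leey.
have within q : (relaxed_perimeter C E < q%:E)%E -> almost_within E (q / 2).
  exact: (relaxed_perimeter_almost_within Cc mE Em).
have ge0 q : (relaxed_perimeter C E < q%:E)%E -> 0 <= q / 2.
  by move=> /within; exact: (almost_within_ge0 mE Em (pi_gt0 R)).
(* The value [-oo] is excluded: [q = -1] would make [-1 / 2] a bound for a distance. *)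
case: (relaxed_perimeter C E) Coo within ge0 => [r| |] // _ within ge0; last first.
  have : 0 <= (-1 : R) / 2 by apply: ge0; rewrite ltNyr.
  by rewrite pmulr_lge0// oppr_ge0 ler10.
have rr : (r%:E < (r + 1)%:E)%E by rewrite lte_fin ltrDl.
have q0 := ge0 _ rr; have wE := within _ rr.
pose D := Num.max 1 ((r + 1) / 2).
have wD : almost_within E D.
  move=> d /wE[A [mA EA AD]]; exists A; split => // x y Ax Ay.
  by rewrite (le_trans (AD x y Ax Ay))// le_max lexx orbT.
have D1 : 1 <= D by rewrite le_max lexx.
have key : c - c * ln (c / 2) - 1 <= r + lam * - (pi ^+ 2 * ln D).
  have -> : lam * - (pi ^+ 2 * ln D) = - (c * ln D) by rewrite /c; ring.
  have [D2|D2] := leP ((r + 1) / 2) 1.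
    by rewrite /D max_l// ln1 mulr0 oppr0; lra.
  rewrite /D max_r ?(ltW D2)//.
  by have := @sub_mul_ln_ge c (r + 1) c0 _; lra.
apply: (@le_trans _ _ (r + lam * - (pi ^+ 2 * ln D))%:E); first by rewrite lee_fin.
rewrite EFinD EFinM leeD2l// lee_pmul2l//.
exact: log_energy_ge.
Qed.

End EnergyBelow.

(** * Convex sets are simply connected, and path connected sets are connected *)

Section Convex.
Context {R : realType}.
Implicit Types E : set (R * R).

Lemma continuous_pair {T : topologicalType} (f g : T -> R) :
  continuous f -> continuous g -> continuous (fun t => (f t, g t) : R * R).
Proof. by move=> cf cg t; exact: (cvg_pair (cf t) (cg t)). Qed.

(** A loop is continuous only within the unit interval; clamping the parameter extends it to the
    line, where homotopies are built by plain composition. *)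
Lemma continuous_clamp (g : R -> R * R) : {within `[0, 1], continuous g} ->
  continuous (fun t : R => g (Num.max 0 (Num.min 1 t))).
Proof.
move=> /subspace_continuousP cg t.
pose k (t : R) : R := Num.max 0 (Num.min 1 t).
have kI s : `[0, 1]%classic (k s).
  by rewrite /= in_itv/= /k le_max lexx/= ge_max ler01/= ge_min lexx.
have ck : k s @[s --> t] --> k t.
  apply: continuous_max; first exact: cst_continuous.
  by apply: continuous_min; [exact: cst_continuous|exact: cvg_id].
apply: (@cvg_comp _ _ _ k g _ (within `[0, 1]%classic (nbhs (k t)))); last exact: cg.
move=> P /= PW.
have ck' : \forall s \near t, `[0, 1]%classic (k s) -> P (k s) by exact: (ck _ PW).
by apply: filterS ck' => s; apply; exact: kI.
Qed.

Lemma clamp_id (t : R) : 0 <= t <= 1 -> Num.max 0 (Num.min 1 t) = t.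
Proof. by move=> /andP[t0 t1]; rewrite min_r// max_r. Qed.

Definition segment_convex E := forall x y t, E x -> E y -> 0 <= t <= 1 ->
  E ((1 - t) * x.1 + t * y.1, (1 - t) * x.2 + t * y.2).

Lemma continuous_affine_comb {T : topologicalType} (s u v : T -> R) :
  continuous s -> continuous u -> continuous v ->
  continuous (fun t => (1 - s t) * u t + s t * v t).
Proof.
move=> cs cu cv t; apply: cvgD; apply: cvgM; [|exact: cu|exact: cs|exact: cv].
by apply: cvgB; [exact: cvg_cst|exact: cs].
Qed.

(** The straight-line contraction to [g 0] stays in [E], and [g 0 = g 1] keeps both ends of the loop
    fixed. *)
Lemma convex_simply_connected E : segment_convex E -> simply_connected E.
Proof.
move=> cE; split.
  move=> x y Ex Ey.
  exists (fun t => ((1 - t) * x.1 + t * y.1, (1 - t) * x.2 + t * y.2)); split.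
  - apply: continuous_subspaceT; apply: continuous_pair;
      by apply: (@continuous_affine_comb R id); [move=> ?; exact: cvg_id|exact: cst_continuous|exact: cst_continuous].
  - by rewrite subr0 !mul1r !mul0r !addr0 -surjective_pairing.
  - by rewrite subrr !mul1r !mul0r !add0r -surjective_pairing.
  - by move=> t t01; exact: cE.
move=> g cg gE g01.
pose G (t : R) := g (Num.max 0 (Num.min 1 t)).
have cG : continuous G by exact: continuous_clamp.
have c1 : continuous (fun z : R * R => (G z.2).1).
  move=> z; apply: (@continuous_comp _ _ _ (fun z : R * R => G z.2) fst); last exact: cvg_fst.
  by apply: (@continuous_comp _ _ _ snd G); [exact: cvg_snd|exact: cG].
have c2 : continuous (fun z : R * R => (G z.2).2).
  move=> z; apply: (@continuous_comp _ _ _ (fun z : R * R => G z.2) snd); last exact: cvg_snd.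
  by apply: (@continuous_comp _ _ _ snd G); [exact: cvg_snd|exact: cG].
have Eg0 : E (g 0) by apply: gE; rewrite lexx ler01.
exists (fun z => ((1 - z.1) * (G z.2).1 + z.1 * (g 0).1, (1 - z.1) * (G z.2).2 + z.1 * (g 0).2)).
split.
- apply: continuous_subspaceT; apply: continuous_pair.
    by apply: (@continuous_affine_comb _ fst); [move=> ?; exact: cvg_fst|exact: c1|exact: cst_continuous].
  by apply: (@continuous_affine_comb _ fst); [move=> ?; exact: cvg_fst|exact: c2|exact: cst_continuous].
- by move=> s t s01 t01 /=; apply: cE => //; rewrite /G clamp_id//; exact: gE.
- move=> t t01 /=; rewrite /G clamp_id// subr0 subrr !mul1r !mul0r !addr0 !add0r.
  by rewrite -!surjective_pairing.
- move=> s s01 /=; rewrite /G !clamp_id ?lexx ?ler01// -g01 -!mulrDl subrK !mul1r.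
  by rewrite -!surjective_pairing.
Qed.

Lemma path_connected_connected E : path_connected E -> connected E.
Proof.
move=> pE; have [->|/set0P[x Ex]] := eqVneq E set0; first exact: connected0.
(* The set is a union of path images through [x]. The implication makes the statement total in [y],
   as [choice] requires. *)
have H (y : R * R) : exists B : set (R * R), E y -> [/\ connected B, B `<=` E, B x & B y].
  have [Ey|nEy] := pselect (E y); last by exists set0.
  have [g [cg g0 g1 gE]] := pE x y Ex Ey; exists (g @` `[0, 1]%classic) => _; split.
  - apply: connected_continuous_connected => //.
    exact/connected_intervalP/interval_is_interval.
  - by move=> _ [t t01 <-]; apply: gE; move: t01; rewrite /= in_itv.
  - by exists 0; rewrite //= in_itv/= lexx ler01.
  - by exists 1; rewrite //= in_itv/= lexx ler01.
have [B HB] := choice H.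
rewrite (_ : E = \bigcup_(y in E) B y).
  apply: bigcup_connected; first by exists x => y /HB[].
  by move=> y /HB[].
apply/seteqP; split => [y Ey|y [z /HB[_ + _ _]]]; last exact.
by exists y => //; case: (HB y Ey).
Qed.

End Convex.

(** * Smoothness and convexity of the superellipse *)

Section Superellipse.
Context {R : realType}.

(** Polynomials times real powers of a fixed [q] are stable under derivation, with the exponent
    falling by one; this closes the induction over all orders. *)
Lemma is_derive_poly_powR (p q : {poly R}) (c t : R) : 0 < q.[t] ->
  is_derive t (1 : R) (fun t : R => p.[t] * q.[t] `^ c)
    ((p^`() * q + c *: (p * q^`())).[t] * q.[t] `^ (c - 1)).
Proof.
move=> q0.
have dp : is_derive t (1 : R) (horner p) p^`().[t] by exact: is_derive_poly.
have dq : is_derive t (1 : R) (horner q) q^`().[t] by exact: is_derive_poly.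
have dw : is_derive q.[t] (1 : R) (@powR R ^~ c) (c * q.[t] `^ (c - 1)).
  exact: is_derive1_powR.
have dc : is_derive t (1 : R) (fun t : R => q.[t] `^ c) (q^`().[t] * (c * q.[t] `^ (c - 1))).
  by rewrite mulrC; exact: (@is_derive1_comp _ (@powR R ^~ c) (horner q) t _ _ dw dq).
have : is_derive t (1 : R) (fun t : R => p.[t] * q.[t] `^ c)
    (p.[t] *: (q^`().[t] * (c * q.[t] `^ (c - 1))) + q.[t] `^ c *: p^`().[t]).
  exact: is_deriveM.
move=> /is_derive_eq; apply.
have -> : q.[t] `^ c = q.[t] * q.[t] `^ (c - 1).
  have -> : q.[t] `^ c = q.[t] `^ 1 * q.[t] `^ (c - 1).
    by rewrite -powRD ?(gt_eqF q0) ?implybT// addrC subrK.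
  by rewrite powRr1// ltW.
by rewrite /GRing.scale/= !hornerE /=; ring.
Qed.

Lemma derive1n_poly_powR (p q : {poly R}) (c : R) (n : nat) : exists r : {poly R},
  forall t, 0 < q.[t] ->
    derive1n n (fun t : R => p.[t] * q.[t] `^ c) t = r.[t] * q.[t] `^ (c - n%:R).
Proof.
elim: n => [|n [r IH]]; first by exists p => t _; rewrite subr0.
exists (r^`() * q + (c - n%:R) *: (r * q^`())) => t q0.
rewrite derive1nS derive1E.
have near0 : \forall s \near t, 0 < q.[s].
  exact: (cvgr_gt q.[t] (@continuous_horner R q t)).
rewrite (@near_eq_derive _ _ _ _ (fun t : R => r.[t] * q.[t] `^ (c - n%:R))).
  have [_ ->] := is_derive_poly_powR r (c - n%:R) q0.
  by rewrite -addrA -opprD -natr1.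
by apply: filterS near0 => s; exact: IH.
Qed.

Lemma derivable_poly_powR (p q : {poly R}) (c t : R) (n : nat) : 0 < q.[t] ->
  derivable (derive1n n (fun t : R => p.[t] * q.[t] `^ c)) t 1.
Proof.
move=> q0; have [r IH] := derive1n_poly_powR p q c n.
have near0 : \forall s \near t, 0 < q.[s].
  exact: (cvgr_gt q.[t] (@continuous_horner R q t)).
apply: (@near_eq_derivable _ _ _ (fun t : R => r.[t] * q.[t] `^ (c - n%:R))).
  by apply: filterS near0 => s qs; rewrite IH.
by have [] := is_derive_poly_powR r (c - n%:R) q0.
Qed.

(** For [c = b] and [|t| < a] its graph is the upper half of the curve bounding [superellipse a b];
    [c = - b] gives the lower half. *)
Definition superarc (a c t : R) : R := c * (1 - (t / a) ^+ 8) `^ 8%:R^-1.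

Lemma derivable_superarc (a c t : R) (n : nat) : (t / a) ^+ 8 < 1 ->
  derivable (derive1n n (superarc a c)) t 1.
Proof.
move=> ta.
pose q : {poly R} := 1 - (a^-1 *: 'X) ^+ 8.
have qE s : q.[s] = 1 - (s / a) ^+ 8 by rewrite /q !hornerE mulrC.
have -> : superarc a c = (fun t : R => (c%:P).[t] * q.[t] `^ 8%:R^-1).
  by apply/funext => s; rewrite /superarc hornerC qE.
by apply: derivable_poly_powR; rewrite qE subr_gt0.
Qed.

Lemma superarcP (a b s t : R) : 0 < b -> (s / a) ^+ 8 < 1 -> 0 <= t ->
  ((s / a) ^+ 8 + (t / b) ^+ 8 < 1) = (t < superarc a b s).
Proof.
move=> b0 sa t0; rewrite /superarc [in RHS]mulrC -ltr_pdivrMr//.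
set Q := 1 - (s / a) ^+ 8; have Q0 : 0 < Q by rewrite subr_gt0.
have -> : ((s / a) ^+ 8 + (t / b) ^+ 8 < 1) = ((t / b) ^+ 8 < Q) by rewrite /Q ltrBrDl.
have {1}-> : Q = (Q `^ 8%:R^-1) ^+ 8.
  by rewrite -powR_mulrn ?powR_ge0// -powRrM mulVf ?pnatr_eq0// powRr1// ltW.
by rewrite ltr_pXn2r// nnegrE ?powR_ge0// divr_ge0// ltW.
Qed.

(* With the exponent 8 the square of half-side 9/10 lies in the unit set, hence
   the constant [81 / 25 = 4 (9/10)^2] below. *)
Definition superellipse (a b : R) : set (R * R) :=
  [set x | (x.1 / a) ^+ 8 + (x.2 / b) ^+ 8 < 1].

Lemma sq_convex (u v t : R) : 0 <= t <= 1 ->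
  ((1 - t) * u + t * v) ^+ 2 <= (1 - t) * u ^+ 2 + t * v ^+ 2.
Proof.
move=> /andP[t0 t1]; rewrite -subr_ge0.
have -> : (1 - t) * u ^+ 2 + t * v ^+ 2 - ((1 - t) * u + t * v) ^+ 2 =
  t * (1 - t) * (u - v) ^+ 2 by ring.
by rewrite mulr_ge0 ?sqr_ge0// mulr_ge0// subr_ge0.
Qed.

(** Squaring a convexity inequality between nonnegative numbers and applying convexity of the square
    doubles the exponent: 2, 4, 8. *)
Lemma pow8_convex (u v t : R) : 0 <= t <= 1 ->
  ((1 - t) * u + t * v) ^+ 8 <= (1 - t) * u ^+ 8 + t * v ^+ 8.
Proof.
move=> t01; have /andP[t0 t1] := t01.
have sq x y : 0 <= x -> x <= y -> x ^+ 2 <= y ^+ 2.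
  by move=> x0 xy; rewrite lerXn2r// nnegrE (le_trans x0).
have step (k : nat) : ((1 - t) * u + t * v) ^+ (2 * k) <= (1 - t) * u ^+ (2 * k) + t * v ^+ (2 * k) ->
    ((1 - t) * u + t * v) ^+ (2 * k * 2) <= (1 - t) * u ^+ (2 * k * 2) + t * v ^+ (2 * k * 2).
  rewrite !(exprM _ (2 * k) 2) => H; apply: le_trans (sq_convex _ _ t01).
  by apply: sq => //; rewrite exprM exprn_ge0 ?sqr_ge0.
by apply: (step 2%N); apply: (step 1%N); exact: sq_convex.
Qed.

Lemma superellipse_convex (a b : R) : segment_convex (superellipse a b).
Proof.
move=> x y t; rewrite /superellipse/= => Ex Ey t01; have /andP[t0 t1] := t01.
have e u v c : ((1 - t) * u + t * v) / c = (1 - t) * (u / c) + t * (v / c) by ring.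
rewrite !e; apply: (le_lt_trans (lerD (pow8_convex _ _ t01) (pow8_convex _ _ t01))).
set A := (x.1 / a) ^+ 8 in Ex *; set B := (x.2 / b) ^+ 8 in Ex *.
set A' := (y.1 / a) ^+ 8 in Ey *; set B' := (y.2 / b) ^+ 8 in Ey *.
have p1 : 0 <= (1 - t) * (1 - (A + B)) by rewrite mulr_ge0// subr_ge0// ltW.
(* Strictness comes from an endpoint with positive weight: [x] if [t = 0], and [y] otherwise. *)
have [tz|tn0] := eqVneq t 0; first by rewrite tz; lra.
have p2 : 0 < t * (1 - (A' + B')) by rewrite mulr_gt0 ?subr_gt0// lt_neqAle eq_sym tn0.
lra.
Qed.

Lemma continuous_superellipse_form (a b : R) :
  continuous (fun x : R * R => (x.1 / a) ^+ 8 + (x.2 / b) ^+ 8).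
Proof.
move=> x; apply: cvgD.
- apply: (@continuous_comp _ _ _ (fun x : R * R => x.1 / a) (fun t : R => t ^+ 8)).
    by apply: cvgM; [exact: cvg_fst|exact: cvg_cst].
  exact: exprn_continuous.
- apply: (@continuous_comp _ _ _ (fun x : R * R => x.2 / b) (fun t : R => t ^+ 8)).
    by apply: cvgM; [exact: cvg_snd|exact: cvg_cst].
  exact: exprn_continuous.
Qed.

Lemma superellipse_boundary (a b : R) (z : R * R) : boundary (superellipse a b) z ->
  (z.1 / a) ^+ 8 + (z.2 / b) ^+ 8 = 1.
Proof.
pose F (x : R * R) := (x.1 / a) ^+ 8 + (x.2 / b) ^+ 8.
have cF := @continuous_superellipse_form a b z.
move=> [z1 z2]; apply/le_anti/andP; split; rewrite leNgt; apply/negP => Fz.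
- have n : \forall x \near z, 1 < F x by exact: (cvgr_gt (F z) cF).
  by have [x [/= xE /lt_trans /(_ xE)]] := z1 _ n; rewrite ltxx.
- have n : \forall x \near z, F x < 1 by exact: (cvgr_lt (F z) cF).
  by have [x [/= xE]] := z2 _ n.
Qed.

Lemma pow8_div_lt1 (a s : R) : 0 < a -> `|s| < a -> (s / a) ^+ 8 < 1.
Proof.
move=> a0 sa; rewrite (_ : (s / a) ^+ 8 = `|s / a| ^+ 8); last first.
  by rewrite -normrX ger0_norm// exprn_even_ge0.
by rewrite exprn_ilt1// normrM normfV (gtr0_norm a0) ltr_pdivrMr// mul1r.
Qed.

Lemma pow8_lt1_norm (a s : R) : 0 < a -> (s / a) ^+ 8 < 1 -> `|s| < a.
Proof.
move=> a0; apply: contraTT; rewrite -!leNgt => sa.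
rewrite (_ : (s / a) ^+ 8 = `|s / a| ^+ 8); last first.
  by rewrite -normrX ger0_norm// exprn_even_ge0.
by rewrite exprn_ege1// normrM normfV (gtr0_norm a0) ler_pdivlMr// mul1r.
Qed.

(* A local graph chart for the curve, over the first coordinate [s] of a
   boundary point whose second coordinate [t] does not vanish. *)
Lemma superarc_chart (a b s t : R) : 0 < a -> 0 < b -> t != 0 ->
  (s / a) ^+ 8 + (t / b) ^+ 8 = 1 ->
  exists (r : R) (h : R -> R), [/\ 0 < r,
    forall n u, `|u - s| < r -> derivable (derive1n n h) u 1 &
    (forall u v, `|s - u| < r -> `|t - v| < r ->
      ((u / a) ^+ 8 + (v / b) ^+ 8 < 1 <-> h u < v)) \/
    (forall u v, `|s - u| < r -> `|t - v| < r ->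
      ((u / a) ^+ 8 + (v / b) ^+ 8 < 1 <-> v < h u))].
Proof.
move=> a0 b0 t0 st.
have tb : 0 < (t / b) ^+ 8.
  by rewrite exprn_even_gt0//= mulf_neq0// invr_eq0 gt_eqF.
have sa : `|s| < a by apply: pow8_lt1_norm => //; lra.
(* The first bound keeps [u] in []-a, a[], where the arc is smooth; the second gives [v] the sign of
   [t], so only one half of the curve is seen. *)
pose r := Num.min (a - `|s|) `|t|.
have r0 : 0 < r by rewrite lt_min subr_gt0 sa normr_gt0.
have ua u : `|s - u| < r -> (u / a) ^+ 8 < 1.
  rewrite lt_min distrC => /andP[us _]; apply: pow8_div_lt1 => //.
  rewrite -[u](subrK s) (le_lt_trans (ler_normD _ _))//; lra.
have [tp|tn] := ltP 0 t.
- exists r, (superarc a b); split => //.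
    by move=> n u us; apply: derivable_superarc; apply: ua; rewrite distrC.
  right=> u v us; rewrite lt_min (gtr0_norm tp) => /andP[_]; rewrite ltr_distl => /andP[_ v0].
  by rewrite superarcP ?ua//; lra.
- have tn' : t < 0 by rewrite lt_neqAle t0.
  exists r, (superarc a (- b)); split => //.
    by move=> n u us; apply: derivable_superarc; apply: ua; rewrite distrC.
  left=> u v us; rewrite lt_min (ltr0_norm tn') => /andP[_]; rewrite ltr_distl => /andP[v0 _].
  have -> : (v / b) ^+ 8 = ((- v) / b) ^+ 8 by rewrite mulNr exprNn -signr_odd/= expr0 mul1r.
  rewrite superarcP ?ua//; last lra.
  by rewrite /superarc mulNr ltrNl; split.
Qed.

Lemma superellipse_smooth (a b : R) : 0 < a -> 0 < b -> smooth_set (superellipse a b).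
Proof.
move=> a0 b0 z /superellipse_boundary zE.
have [z20|z20] := eqVneq z.2 0; last first.
  have [r [h [r0 dh H]]] := superarc_chart a0 b0 z20 zE.
  exists r, h; split => //; left; split => //.
  by case: H => H; [left|right] => x [x1 x2]; exact: H.
have z10 : z.1 != 0.
  apply/eqP => z10; move: zE; rewrite z10 z20 !mul0r expr0n/= addr0 => /eqP.
  by rewrite eq_sym oner_eq0.
(* The equation is symmetric under exchange of the coordinates together with the semi-axes. *)
rewrite addrC in zE; have [r [h [r0 dh H]]] := superarc_chart b0 a0 z10 zE.
exists r, h; split => //; right; split => //.
by case: H => H; [left|right] => x [x1 x2]; rewrite /superellipse/= addrC; exact: H.
Qed.

End Superellipse.

(** * Area and perimeter of the superellipse by slicing *)

Section SuperellipseMeasures.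
Context {R : realType}.
Local Notation leb := (@lebesgue_measure R).

Lemma C1c_C1_pair1 (f : R * R -> R) (y : R) : C1c f ->
  C1_pair (fun x => f (x, y)) (fun x => 'D_((1, 0) : R * R) f (x, y)).
Proof.
move=> [_ [d _] c _]; split=> x.
  have E : (fun h : R => h^-1 *: (((fun x => f (x, y)) \o shift x) (h *: (1 : R)) - f (x, y))) =
      (fun h : R => h^-1 *: ((f \o shift (x, y)) (h *: ((1, 0) : R * R)) - f (x, y))).
    apply/funext => h /=; congr (_ *: (f _ - _)).
    by rewrite [RHS]surjective_pairing /= scaler0 add0r.
  by split; [rewrite /derivable E; exact: d|rewrite /derive E].
have cp : continuous (fun x : R => (x, y) : R * R).
  by apply: continuous_pair; [move=> t; exact: cvg_id|exact: cst_continuous].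
exact: (continuous_comp (cp x) (c (x, y))).
Qed.

Lemma C1c_C1_pair2 (f : R * R -> R) (x : R) : C1c f ->
  C1_pair (fun y => f (x, y)) (fun y => 'D_((0, 1) : R * R) f (x, y)).
Proof.
move=> [_ [_ d] _ c]; split=> y.
  have E : (fun h : R => h^-1 *: (((fun y => f (x, y)) \o shift y) (h *: (1 : R)) - f (x, y))) =
      (fun h : R => h^-1 *: ((f \o shift (x, y)) (h *: ((0, 1) : R * R)) - f (x, y))).
    apply/funext => h /=; congr (_ *: (f _ - _)).
    by rewrite [RHS]surjective_pairing /= scaler0 add0r.
  by split; [rewrite /derivable E; exact: d|rewrite /derive E].
have cp : continuous (fun y : R => (x, y) : R * R).
  by apply: continuous_pair; [exact: cst_continuous|move=> t; exact: cvg_id].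
exact: (continuous_comp (cp y) (c (x, y))).
Qed.

Lemma C1_pair_slice_le (f f' : R -> R) (w : R) : C1_pair f f' -> (forall x, `|f x| <= 1) ->
  (\int[leb]_(x in `](- w)%R, w[) (f' x)%:E <= 2%:E)%E.
Proof.
move=> Cf f1; have [w0|w0] := leP w 0.
  by rewrite set_itv_ge ?integral_set0 ?lee_fin// bnd_simp -leNgt (le_trans w0)// oppr_ge0.
have mf D : measurable D -> measurable_fun D (fun x : measurableTypeR R => (f' x)%:E).
  move=> mD; apply/measurable_EFinP/measurable_funTS.
  by apply: continuous_measurable_fun; exact: Cf.2.
rewrite integral_itv_bndo_bndc; last exact: mf.
rewrite integral_itv_obnd_cbnd; last exact: mf.
rewrite (C1_pair_integral Cf); last lra.
by have := f1 w; have := f1 (- w); rewrite lee_fin !ler_norml; lra.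
Qed.

Lemma superellipse_slice1 (a b x y : R) : 0 < a -> 0 < b ->
  superellipse a b (x, y) <-> `](- b), b[%classic y /\
    `](- superarc b a y), (superarc b a y)[%classic x.
Proof.
move=> a0 b0; rewrite /superellipse/= !in_itv/= -!ltr_norml addrC.
have e : (x / a) ^+ 8 = (`|x| / a) ^+ 8.
  by rewrite -[in RHS](gtr0_norm a0) -normf_div -normrX ger0_norm// exprn_even_ge0.
split=> [H|[yb]].
  have yb : (y / b) ^+ 8 < 1 by rewrite (le_lt_trans _ H)// lerDl exprn_even_ge0.
  by split; [exact: pow8_lt1_norm|rewrite -superarcP -?e].
by rewrite -superarcP -?e//; exact: pow8_div_lt1.
Qed.

Lemma superellipse_slice2 (a b x y : R) : 0 < a -> 0 < b ->
  superellipse a b (x, y) <-> `](- a), a[%classic x /\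
    `](- superarc a b x), (superarc a b x)[%classic y.
Proof.
move=> a0 b0; rewrite -(superellipse_slice1 y x b0 a0) /superellipse/= addrC.
by split.
Qed.

Lemma superellipse_open (a b : R) : 0 < a -> 0 < b -> open (superellipse a b).
Proof. by move=> a0 b0; apply: smooth_set_open; exact: superellipse_smooth. Qed.

Lemma superellipse_measurable (a b : R) : 0 < a -> 0 < b ->
  measurable (superellipse a b : set (mplane R)).
Proof. by move=> a0 b0; exact: (open_plane_measurable (superellipse_open a0 b0)). Qed.

Lemma lebesgue2_rectangle (a b : R) : 0 < a -> 0 < b ->
  (lebesgue2 R (`](- a)%R, a[%classic `*` `](- b)%R, b[%classic) = (2 * a * (2 * b))%:E)%E.
Proof.
move=> a0 b0.
have -> : (lebesgue2 R (`](- a)%R, a[%classic `*` `](- b)%R, b[%classic) =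
  leb `](- a)%R, a[%classic * leb `](- b)%R, b[%classic)%E.
  by apply: product_measure1E; exact: measurable_itv.
by rewrite !lebesgue_measure_itv/= !lte_fin !ifT -?EFinB -?EFinM; [congr EFin; ring|lra|lra].
Qed.

Lemma superellipse_finite_area (a b : R) : 0 < a -> 0 < b -> finite_area (superellipse a b).
Proof.
move=> a0 b0; rewrite /finite_area.
apply: (@le_lt_trans _ _ (lebesgue2 R (`](- a)%R, a[%classic `*` `](- b)%R, b[%classic))).
  apply: le_measure; rewrite ?inE.
  - exact: superellipse_measurable.
  - by apply: measurableX; exact: measurable_itv.
  - move=> [x y] H; split => /=.
      by case/(superellipse_slice2 x y a0 b0): H.
    by case/(superellipse_slice1 x y a0 b0): H.
by rewrite lebesgue2_rectangle// ltry.
Qed.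

Lemma superellipse_area_ge (a : R) : 0 < a ->
  ((81 / 25 * a)%:E <= lebesgue2 R (superellipse a 1))%E.
Proof.
move=> a0; have a9 : 0 < 9 / 10 * a by rewrite mulr_gt0.
have n9 : 0 < 9 / 10 :> R by [].
apply: (@le_trans _ _ (lebesgue2 R (`](- (9 / 10 * a))%R, (9 / 10 * a)%R[%classic `*`
    `](- (9 / 10))%R, (9 / 10)%R[%classic))).
  by rewrite (lebesgue2_rectangle a9 n9) lee_fin; lra.
apply: le_measure; rewrite ?inE.
- by apply: measurableX; exact: measurable_itv.
- exact: superellipse_measurable.
- move=> [x y] [/= x9 y9]; rewrite /superellipse/=.
  (* [(9 / 10) ^+ 8] is about 0.43, so two such terms sum to less than 1. *)
  have k (u : R) : `|u| < 9 / 10 -> u ^+ 8 < 1 / 2.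
    move=> u9; have -> : u ^+ 8 = `|u| ^+ 8 by rewrite -normrX ger0_norm// exprn_even_ge0.
    apply: (@lt_trans _ _ ((9 / 10) ^+ 8)); first by rewrite ltrXn2r.
    by rewrite !exprS expr0; lra.
  have xa : `|x / a| < 9 / 10.
    by rewrite normf_div (gtr0_norm a0) ltr_pdivrMr//; move: x9; rewrite in_itv/= ltr_norml.
  have ya : `|y / 1| < 9 / 10 by move: y9; rewrite divr1 in_itv/= ltr_norml.
  by have := k _ xa; have := k _ ya; lra.
Qed.

(** Vertical sections have length linear in [b]. The area can thus be normalized to [pi] through [b]
    alone, without being evaluated. *)
Lemma superellipse_area_scale (a b : R) : 0 < a -> 0 < b ->
  (lebesgue2 R (superellipse a b) = b%:E * lebesgue2 R (superellipse a 1))%E.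
Proof.
move=> a0 b0.
have sec c (x : R) : 0 < c ->
    leb (xsection (superellipse a c : set (mplane R)) x) =
    (c * (2 * superarc a 1 x) * \1_(`](- a)%R, a[%classic) x)%:E.
  move=> c0; have arcE : superarc a c x = c * superarc a 1 x by rewrite /superarc mul1r.
  have arc0 : 0 <= superarc a c x by rewrite mulr_ge0 ?powR_ge0// ltW.
  rewrite indicE; case: (boolP (x \in _)) => xa; last first.
    rewrite mulr0 (_ : xsection _ _ = set0) ?measure0//.
    apply/seteqP; split => y //; rewrite /xsection/= inE => /(superellipse_slice2 x y a0 c0)[xa'].
    by move/negP: xa; rewrite inE.
  rewrite (_ : xsection _ _ = `](- superarc a c x)%R, (superarc a c x)%R[%classic); last first.
    apply/seteqP; split => y; rewrite /xsection/= inE.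
      by move=> /(superellipse_slice2 x y a0 c0)[].
    by move=> H; apply/(superellipse_slice2 x y a0 c0); split => //; move: xa; rewrite inE.
  rewrite lebesgue_measure_itv/= lte_fin mulr1; case: ifPn => [_|H].
    by rewrite -EFinB arcE; congr EFin; ring.
  have : superarc a c x = 0 by lra.
  by rewrite arcE => H0; rewrite mulrCA H0 mulr0.
have areaE c : 0 < c -> (lebesgue2 R (superellipse a c) =
    \int[leb]_x (c * (2 * superarc a 1 x) * \1_(`](- a)%R, a[%classic) x)%:E)%E.
  by move=> c0; apply: eq_integral => x _; exact: sec.
have m1 := measurable_fun_xsection leb (superellipse_measurable a0 ltr01).
rewrite !areaE// -ge0_integralZl_EFin//; last 3 first.
- move=> x _; rewrite -(sec 1 x ltr01); exact: measure_ge0.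
- apply: eq_measurable_fun m1 => x _; exact: sec 1 x ltr01.
- exact: ltW.
by apply: eq_integral => x _; rewrite -EFinM; congr EFin; ring.
Qed.

Lemma slices_integral_le (b : R) (G : R -> \bar R) : 0 < b ->
  measurable_fun (setT : set (measurableTypeR R)) G -> (forall y, `](- b), b[%classic y -> (G y <= 2%:E)%E) ->
  (forall y, ~ `](- b), b[%classic y -> G y = 0%E) ->
  (\int[leb]_y G y <= (4 * b)%:E)%E.
Proof.
move=> b0 mG G2 G0.
have J : (leb `](- b)%R, b[%classic = (2 * b)%:E)%E.
  by rewrite lebesgue_measure_itv/= lte_fin ifT -?EFinB; [congr EFin; ring|lra].
have Joo : (leb `](- b)%R, b[%classic < +oo)%E by rewrite J ltry.
have IC : (\int[leb]_(y in `](- b)%R, b[) (cst 2%:E y) = (4 * b)%:E)%E.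
  transitivity (2%:E * leb `](- b)%R, b[%classic)%E; first exact: integral_cst.
  by rewrite J -EFinM; congr EFin; ring.
have -> : (\int[leb]_y G y = \int[leb]_(y in `](- b)%R, b[) G y)%E.
  rewrite [RHS]integral_mkcond; apply: eq_integral => y _; rewrite patchE.
  case: ifPn => // yb; apply: G0 => yb'; by move: yb; rewrite mem_set.
apply: (@le_trans _ _ (\int[leb]_(y in `](- b)%R, b[) (cst 2%:E y))%E).
  rewrite integralE; apply: (@le_trans _ _ (\int[leb]_(y in `](- b)%R, b[) G^\+ y)%E).
    by rewrite -[leRHS]sube0; apply: leeB => //; exact: integral_ge0.
  apply: ge0_le_integral => //; first exact/measurable_funepos/measurable_funTS.
  by move=> y yb; rewrite funeposE ge_max G2//= lee_fin.
by rewrite IC.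
Qed.

(** Each partial derivative is integrated along its own direction first. The slices are intervals,
    each contributing at most 2, over projections of lengths [2 * b] and [2 * a]; the result is the
    perimeter of the bounding box. *)
Lemma superellipse_perimeter_le (a b : R) : 0 < a -> 0 < b ->
  (perimeter (superellipse a b) <= (4 * a + 4 * b)%:E)%E.
Proof.
move=> a0 b0; set E := superellipse a b.
have mE : measurable (E : set (mplane R)) := superellipse_measurable a0 b0.
have fE := superellipse_finite_area a0 b0.
apply: ge_ereal_sup => _ [f [g [Cf Cg fg1 ->]]].
have [i1 _] := C1c_integrable Cf mE fE; have [_ i2] := C1c_integrable Cg mE fE.
have [f1 g1] : (forall x, `|f x| <= 1) /\ (forall x, `|g x| <= 1).
  by split=> x; apply: le_trans (fg1 x); rewrite -sqrtr_sqr /enorm ler_wsqrtr//= ?lerDl ?lerDr sqr_ge0.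
have -> : (\int[lebesgue2 R]_(x in E) (divergence f g x)%:E =
    \int[lebesgue2 R]_(x in E) ('D_((1, 0) : R * R) f x)%:E +
    \int[lebesgue2 R]_(x in E) ('D_((0, 1) : R * R) g x)%:E)%E.
  exact: (integralD_EFin mE i1 i2).
rewrite [4 * a + _]addrC EFinD; apply: leeD.
- have := (integrable_mkcond _ mE).1 i1; set H := (_ \_ _) => iH.
  have -> : (\int[lebesgue2 R]_(x in E) ('D_((1, 0) : R * R) f x)%:E = \int[lebesgue2 R]_x H x)%E.
    exact: integral_mkcond.
  have -> : (\int[lebesgue2 R]_x H x = \int[leb]_y fubini_G leb H y)%E.
    exact/esym/(integral21_prod_meas1 iH).
  apply: slices_integral_le => //; first exact: (measurable_fubini_G iH).
    move=> y yb; apply: le_trans (C1_pair_slice_le (superarc b a y) (C1c_C1_pair1 y Cf) (fun x => f1 (x, y))).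
    rewrite /fubini_G [leRHS]integral_mkcond le_eqVlt; apply/orP; left; apply/eqP.
    apply: eq_integral => x _; rewrite /H !patchE.
    congr (if _ then _ else _); apply/idP/idP; rewrite !inE => He.
      by case/(superellipse_slice1 x y a0 b0): He.
    by apply/(superellipse_slice1 x y a0 b0).
  move=> y yb; rewrite /fubini_G (_ : (fun x => H (x, y)) = cst 0%E) ?integral0//.
  apply/funext => x; rewrite /H patchE ifF//; apply/negP; rewrite inE => He; apply: yb.
  by case/(superellipse_slice1 x y a0 b0): He.
- have := (integrable_mkcond _ mE).1 i2; set H := (_ \_ _) => iH.
  have -> : (\int[lebesgue2 R]_(x in E) ('D_((0, 1) : R * R) g x)%:E = \int[lebesgue2 R]_x H x)%E.
    exact: integral_mkcond.
  have -> : (\int[lebesgue2 R]_x H x = \int[leb]_x fubini_F leb H x)%E.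
    exact/esym/(integral12_prod_meas1 iH).
  apply: slices_integral_le => //; first exact: (measurable_fubini_F iH).
    move=> x xa; apply: le_trans (C1_pair_slice_le (superarc a b x) (C1c_C1_pair2 x Cg) (fun y => g1 (x, y))).
    rewrite /fubini_F [leRHS]integral_mkcond le_eqVlt; apply/orP; left; apply/eqP.
    apply: eq_integral => y _; rewrite /H !patchE.
    congr (if _ then _ else _); apply/idP/idP; rewrite !inE => He.
      by case/(superellipse_slice2 x y a0 b0): He.
    by apply/(superellipse_slice2 x y a0 b0).
  move=> x xa; rewrite /fubini_F (_ : (fun y => H (x, y)) = cst 0%E) ?integral0//.
  apply/funext => y; rewrite /H patchE ifF//; apply/negP; rewrite inE => He; apply: xa.
  by case/(superellipse_slice2 x y a0 b0): He.
Qed.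

End SuperellipseMeasures.

(** * Upper bound of the logarithmic energy of a set in a strip *)

Section LogEnergyAbove.
Context {R : realType}.
Local Notation leb := (@lebesgue_measure R).

(** The positive part of [f] is dominated by an integrable function, so if [f] is not integrable
    then its negative part has infinite integral, and the integral of [f] is [-oo]. *)
Lemma integral_le_add (d : measure_display) (T : measurableType d)
    (m : {measure set T -> \bar R}) (D : set T) (f G : T -> \bar R) (C K M : R) :
  measurable D -> m D = M%:E -> measurable_fun D f -> measurable_fun D G ->
  (forall x, D x -> (0 <= G x)%E) -> (forall x, D x -> (f x <= C%:E + G x)%E) ->
  (\int[m]_(x in D) G x <= K%:E)%E ->
  (\int[m]_(x in D) f x <= (C * M + K)%:E)%E.
Proof.
move=> mD DM mf mG G0 fG GK.
have iG : m.-integrable D G.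
  apply/integrableP; split => //; apply: le_lt_trans (ltry K); apply: le_trans GK.
  by rewrite le_eqVlt; apply/orP; left; apply/eqP; apply: eq_integral => x /set_mem Dx; rewrite gee0_abs// G0.
have iC : m.-integrable D (EFin \o cst C).
  apply: measurable_bounded_integrable => //; first by rewrite DM ltry.
  by exists `|C|; split; [exact: num_real|move=> N CN x _ /=; exact: ltW].
have iH : m.-integrable D (fun x => C%:E + G x)%E by exact: integrableD.
have HE : (\int[m]_(x in D) (C%:E + G x) <= (C * M + K)%:E)%E.
  have -> : (\int[m]_(x in D) (C%:E + G x) = \int[m]_(x in D) (EFin \o cst C) x + \int[m]_(x in D) G x)%E.
    exact: integralD.
  rewrite EFinD; apply: leeD => //.
  have -> : (\int[m]_(x in D) (EFin \o cst C) x = C%:E * m D)%E by exact: (integral_cst m mD C%:E).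
  by rewrite DM -EFinM.
have [iF|niF] := pselect (m.-integrable D f).
  by apply: le_trans HE; apply: le_integral => // x /set_mem; exact: fG.
have fp : (\int[m]_(x in D) f^\+ x < +oo)%E.
  have /integrableP[_ Hoo] := iH; apply: le_lt_trans Hoo; apply: ge0_le_integral => //.
  - exact: measurable_funepos.
  - by apply: measurableT_comp => //; exact: measurable_int iH.
  - move=> x Dx; rewrite funeposE ge_max abse_ge0 andbT.
    by apply: le_trans (fG x Dx) _; exact: lee_abs.
have fm : (\int[m]_(x in D) f^\- x = +oo)%E.
  apply: contrapT => /eqP; rewrite -ltey => fm; apply: niF; apply/integrableP; split => //.
  have -> : (\int[m]_(x in D) `|f x| = \int[m]_(x in D) (f^\+ x + f^\- x))%E.
    by apply: eq_integral => x _; rewrite -/((abse \o f) x) fune_abse.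
  rewrite ge0_integralD//; [exact: lte_add_pinfty|exact: measurable_funepos|exact: measurable_funeneg].
rewrite integralE fm; move: fp; case: (integral _ _ _) => [r| |] //= _.
all: by rewrite leNye.
Qed.

(** The region under the graph of [max 0 (ln (a / |c - u|))], written without logarithm so that
    [u = c] needs no separate treatment. *)
Definition layer_set (c a : R) : set (mplane R) :=
  [set p | 0 <= p.2 /\ `|c - p.1| < a * expR (- p.2)].

Lemma measurable_layer_set (c a : R) : measurable (layer_set c a).
Proof.
have -> : layer_set c a = [set: R] `*` `[0, +oo[%classic `&`
    [set p | 0 < a * expR (- p.2) - `|c - p.1|].
  apply/seteqP; split => p /=; rewrite in_itv/= andbT subr_gt0; first by move=> [? ?].
  by move=> [[_ ?] ?].
apply: measurableI; first by apply: measurableX => //; exact: measurable_itv.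
apply: open_plane_measurable.
have cF : continuous (fun p : R * R => a * expR (- p.2) - `|c - p.1|).
  move=> p; apply: cvgB.
    apply: cvgM; first exact: cvg_cst.
    apply: (@continuous_comp _ _ _ (fun p : R * R => - p.2) expR); last exact: continuous_expR.
    by apply: cvgN; exact: cvg_snd.
  by apply: cvg_norm; apply: cvgB; [exact: cvg_cst|exact: cvg_fst].
have -> : [set p : R * R | 0 < a * expR (- p.2) - `|c - p.1|] =
    (fun p : R * R => a * expR (- p.2) - `|c - p.1|) @^-1` [set t | 0 < t] by [].
by apply: open_comp; [move=> p _; exact: cF|exact: open_gt].
Qed.

(* Layer-cake form of [max 0 (ln (a / |c - u|))], with value [+oo] at [u = c]. *)
Definition log_layer (c a u : R) : \bar R :=
  (\int[leb]_s (\1_(layer_set c a) (u, s))%:E)%E.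

Let layer_fun (c a : R) (p : mplane R) : \bar R := (\1_(layer_set c a) p : R)%:E.

Let measurable_layer_fun (c a : R) : measurable_fun setT (layer_fun c a).
Proof. by apply/measurable_EFinP; apply: measurable_indic; exact: measurable_layer_set. Qed.

Lemma log_layer_ge0 (c a u : R) : (0 <= log_layer c a u)%E.
Proof. by apply: integral_ge0 => s _; rewrite lee_fin. Qed.

Lemma measurable_log_layer (c a : R) :
  measurable_fun (setT : set (measurableTypeR R)) (log_layer c a).
Proof.
by apply: (measurable_fun_fubini_tonelli_F (m2 := leb) _ (@measurable_layer_fun c a)) => p; rewrite lee_fin.
Qed.

Lemma log_layer_ge (c a u T : R) : 0 < a -> 0 <= T -> `|c - u| <= a * expR (- T) ->
  (T%:E <= log_layer c a u)%E.
Proof.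
move=> a0 T0 cu.
have mT : measurable (`[0, T[%classic : set (measurableTypeR R)) by exact: measurable_itv.
have TE : (T%:E = \int[leb]_s (\1_(`[0%R, T[%classic) s)%:E)%E.
  have -> : (\int[leb]_s (\1_(`[0%R, T[%classic) s)%:E = leb (`[0%R, T[%classic `&` setT))%E.
    exact: integral_indic.
  rewrite setIT lebesgue_measure_itv/= lte_fin; case: ltP => [_|T0']; first by rewrite -EFinB subr0.
  by congr EFin; apply/le_anti; rewrite T0 T0'.
rewrite TE; apply: ge0_le_integral => //.
- by apply/measurable_EFinP; exact: measurable_indic.
- exact: (measurableT_comp (@measurable_layer_fun c a) (measurable_pair1 (T1 := measurableTypeR R) u)).
- move=> s _; rewrite lee_fin !indicE; case: (boolP (s \in _)) => [sT|_]; last by rewrite ler0n.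
  move: sT; rewrite inE/= in_itv/= => /andP[s0 sT]; rewrite mem_set//; split => //=.
  by rewrite (le_lt_trans cu)// ltr_pM2l// ltr_expR ltrN2.
Qed.

(** With [u] integrated first, the section at height [s >= 0] has length [2 * a * expR (- s)], which
    is [2 * a] times the exponential density of rate 1. *)
Lemma integral_log_layer (c a : R) : 0 < a ->
  (\int[leb]_u log_layer c a u = (2 * a)%:E)%E.
Proof.
move=> a0.
have f0 p : (0 <= layer_fun c a p)%E by rewrite lee_fin.
have -> : (\int[leb]_u log_layer c a u = \int[leb]_s fubini_G leb (layer_fun c a) s)%E.
  exact: (fubini_tonelli _ (@measurable_layer_fun c a) f0).
have sec s : fubini_G leb (layer_fun c a) s = ((2 * a)%:E * (exponential_pdf 1 s)%:E)%E.
  rewrite /fubini_G /exponential_pdf patchE; case: ifPn => s0; last first.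
    rewrite mule0 (_ : (fun u => _) = cst 0%E) ?integral0//.
    apply/funext => u; rewrite /layer_fun indicE memNset// => -[/= s0' _].
    by move: s0; rewrite notin_setE/= in_itv/= s0'.
  pose w := a * expR (- s); have w0 : 0 < w by rewrite mulr_gt0 ?expR_gt0.
  have {}s0 : 0 <= s by move: s0; rewrite inE/= in_itv/= andbT.
  have -> : (\int[leb]_u layer_fun c a (u, s) = \int[leb]_u (\1_(`](c - w)%R, (c + w)%R[%classic) u)%:E)%E.
    apply: eq_integral => u _; rewrite /layer_fun !indicE; congr ((nat_of_bool _)%:R%:E).
    apply/idP/idP; rewrite !inE /layer_set/= in_itv/= -/w distrC ltr_distl; first by case.
    by move=> ?; split.
  have mI : measurable (`](c - w)%R, (c + w)%R[%classic : set (measurableTypeR R)) by exact: measurable_itv.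
  have -> : (\int[leb]_u (\1_(`](c - w)%R, (c + w)%R[%classic) u)%:E = leb (`](c - w)%R, (c + w)%R[%classic `&` setT))%E.
    exact: integral_indic.
  rewrite setIT lebesgue_measure_itv/= lte_fin ifT; last lra.
  by rewrite -EFinB -EFinM mulN1r /w; congr EFin; ring.
have -> : (\int[leb]_s fubini_G leb (layer_fun c a) s =
    \int[leb]_s ((2 * a)%:E * (exponential_pdf 1 s)%:E))%E.
  by apply: eq_integral => s _; exact: sec.
rewrite ge0_integralZl_EFin//.
- by rewrite integral_exponential_pdf// mule1.
- by move=> s _; rewrite lee_fin exponential_pdf_ge0.
- by apply/measurable_EFinP; exact: measurable_exponential_pdf.
- by rewrite mulr_ge0// ltW.
Qed.

(** Nonnegativity lets [E] grow to the whole strip of width [2 * b], over which the first variable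
    integrates to [2 * a] for every centre [c]. *)
Lemma integral_strip_log_layer (E : set (mplane R)) (a b c : R) : 0 < a -> 0 < b ->
  measurable E -> (forall y, E y -> `](- b), b[%classic y.2) ->
  (\int[lebesgue2 R]_(y in E) log_layer c a y.1 <= (4 * a * b)%:E)%E.
Proof.
move=> a0 b0 mE Eb.
pose J : set (measurableTypeR R) := `](- b), b[%classic.
have mJ : measurable J by exact: measurable_itv.
pose h (y : mplane R) : \bar R := ((\1_J y.2 : R)%:E * log_layer c a y.1)%E.
have mh : measurable_fun setT h.
  apply: emeasurable_funM; last exact: (measurableT_comp (measurable_log_layer c a) measurable_fst).
  by apply/measurable_EFinP; exact: (measurableT_comp (measurable_indic mJ) measurable_snd).
have h0 y : (0 <= h y)%E by rewrite mule_ge0 ?log_layer_ge0// lee_fin.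
apply: (@le_trans _ _ (\int[lebesgue2 R]_y h y)%E).
  apply: (@le_trans _ _ (\int[lebesgue2 R]_(y in E) h y)%E).
    rewrite le_eqVlt; apply/orP; left; apply/eqP; apply: eq_integral => y /set_mem Ey.
    by rewrite /h indicE mem_set ?mul1e//; exact: Eb.
  by apply: ge0_subset_integral.
have -> : (\int[lebesgue2 R]_y h y = \int[leb]_y fubini_G leb h y)%E.
  exact: (fubini_tonelli2 _ mh h0).
have -> : (\int[leb]_y fubini_G leb h y = \int[leb]_y ((2 * a)%:E * (\1_J y)%:E))%E.
  apply: eq_integral => y _; rewrite /fubini_G /h /=.
  have -> : (\int[leb]_x ((\1_J y)%:E * log_layer c a x) = (\1_J y)%:E * \int[leb]_x log_layer c a x)%E.
    apply: ge0_integralZl_EFin => //; [by move=> x _; exact: log_layer_ge0|exact: measurable_log_layer].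
  by rewrite integral_log_layer// muleC.
have m1 : measurable_fun setT (fun y => (\1_J y : R)%:E) by apply/measurable_EFinP; exact: measurable_indic.
have a20 : 0 <= 2 * a by rewrite mulr_ge0// ltW.
rewrite ge0_integralZl_EFin//.
have -> : (\int[leb]_y (\1_J y)%:E = leb (J `&` setT))%E by exact: integral_indic.
rewrite setIT /J lebesgue_measure_itv/= lte_fin ifT; last lra.
by rewrite -EFinB -EFinM lee_fin; lra.
Qed.

Lemma enorm_ge1 (x y : R * R) : `|x.1 - y.1| <= enorm (x - y).
Proof. by rewrite /enorm -sqrtr_sqr ler_wsqrtr//= lerDl sqr_ge0. Qed.

(** Since [n >= |x.1 - y.1|], the layer reaches the height [T], which is [ln (a / n)] off the
    diagonal. If [n = 0], every height is reached. *)
Lemma log_kernel_le (x y : R * R) (a : R) : 0 < a ->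
  ((ln (enorm (x - y))^-1)%:E <= (- ln a)%:E + log_layer x.1 a y.1)%E.
Proof.
move=> a0; set n := enorm (x - y); set T := ln n^-1 + ln a.
have xyn : `|x.1 - y.1| <= n by exact: enorm_ge1.
have nT : ln n^-1 = - ln a + T by rewrite /T; ring.
rewrite nT EFinD leeD2l//; have [T0|T0] := leP T 0.
  by apply: le_trans (log_layer_ge0 _ _ _); rewrite lee_fin.
apply: log_layer_ge => //; first exact: ltW.
apply: (le_trans xyn); have := le_trans (normr_ge0 _) xyn; rewrite le_eqVlt => /orP[/eqP <-|n0].
  by rewrite mulr_ge0 ?expR_ge0// ltW.
rewrite /T lnV ?posrE// opprD opprK expRD lnK ?posrE// expRN lnK ?posrE//.
by rewrite mulrCA mulfV ?mulr1// gt_eqF.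
Qed.

Lemma log_energy_le (E : set (mplane R)) (a b m : R) : 0 < a -> 0 < b ->
  measurable E -> lebesgue2 R E = m%:E -> (forall y, E y -> `](- b), b[%classic y.2) ->
  (log_energy E <= ((- ln a * m + 4 * a * b) * m)%:E)%E.
Proof.
move=> a0 b0 mE Em Eb.
have pot x : (log_potential E x <= (- ln a * m + 4 * a * b)%:E)%E.
  apply: (@integral_le_add _ _ (lebesgue2 R) E _ (fun y => log_layer x.1 a y.1)) => //.
  - apply: measurable_funTS; apply/measurable_EFinP.
    exact: (measurableT_comp measurable_log_kernel (measurable_pair1 x)).
  - apply: measurable_funTS; exact: (measurableT_comp (measurable_log_layer x.1 a) measurable_fst).
  - by move=> y _; exact: log_layer_ge0.
  - by move=> y _; exact: log_kernel_le.
  - exact: integral_strip_log_layer.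
rewrite -[X in (_ <= X%:E)%E]addr0.
apply: (@integral_le_add _ _ (lebesgue2 R) E (log_potential E) (cst 0%E)) => //.
- exact: measurable_funTS (measurable_log_potential mE).
- by move=> x _; rewrite adde0; exact: pot.
- by rewrite integral0.
Qed.

End LogEnergyAbove.

(** * The competitor, the two-sided bound and the coefficient functions *)

Section Assembly.
Context {R : realType}.

(** The constant sequence is admissible, so a smooth competitor needs no approximation. *)
Lemma relaxed_perimeter_le (C : set (set (R * R))) (E : set (R * R)) :
  C E -> (relaxed_perimeter C E <= perimeter E)%E.
Proof.
move=> CE; apply: ereal_inf_lbound; exists (fun=> E); split => //.
- rewrite /cvg_L1 (_ : (fun n => _) = cst 0%E); first exact: cvg_cst.
  apply/funext => n; apply: integral0_eq => x _; by rewrite subrr normr0.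
- rewrite is_cvg_limn_einfE; last exact: is_cvg_cst.
  by rewrite lim_cst.
Qed.

(** From [2 <= (1 + 19 / 100) ^+ 4] and [ln (1 + x) <= x]. The value is sharp enough for
    [1 + 19 / 25 + 100 / 81 < 3]. *)
Lemma ln2_le : ln 2 <= 19 / 25 :> R.
Proof.
have h : (2 : R) <= (1 + 19 / 100) ^+ 4 by rewrite !exprS expr0; lra.
have p : 0 < 1 + 19 / 100 :> R by lra.
apply: (@le_trans _ _ (ln ((1 + 19 / 100 : R) ^+ 4))).
  by rewrite ler_ln ?posrE ?exprn_gt0//.
have h2 : ln (1 + 19 / 100) <= 19 / 100 :> R by apply: le_ln1Dx; lra.
rewrite lnXn//; move: (ln _) h2 => l h2.
by rewrite -[l *+ 4]mulr_natl; lra.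
Qed.

Lemma pi_lt4 : pi < 4 :> R.
Proof. by have /andP[_] := @pihalf_02 R; lra. Qed.

(* The energies of the superellipses with semi-axes [a = pi ^+ 2 * lam / 4] and
   [b = pi / kappa], where [kappa] is the area for [b = 1]. *)
Lemma exists_competitor (lam : R) : 8 <= pi ^+ 2 * lam -> 0 < lam ->
  exists a b : R, [/\ 0 < a, 0 < b, lebesgue2 R (superellipse a b) = pi%:E &
    forall C : set (set (R * R)), C (superellipse a b) ->
    (energy C lam (superellipse a b) <=
      (3 * (pi ^+ 2 * lam) - pi ^+ 2 * lam * ln (pi ^+ 2 * lam / 2) + 4)%:E)%E].
Proof.
set c := pi ^+ 2 * lam => c8 lam0.
have pi0 := pi_gt0 R; have pi4 := pi_lt4.
(* This [a] minimizes [4 * a - c * ln a], the part of the energy bound that grows with [a]. *)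
pose a := c / 4; have a0 : 0 < a by rewrite /a; lra.
have fin := superellipse_finite_area a0 (@ltr01 R).
pose kappa := fine (lebesgue2 R (superellipse a 1)).
have kE : lebesgue2 R (superellipse a 1) = kappa%:E.
  by rewrite /kappa fineK// ge0_fin_numE//; exact: measure_ge0.
have ka : 81 / 25 * a <= kappa by rewrite -lee_fin -kE; exact: superellipse_area_ge.
have {kE fin} area : forall b, 0 < b -> lebesgue2 R (superellipse a b) = (b * kappa)%:E.
  by move=> b b0; rewrite superellipse_area_scale// EFinM; congr (_ * _)%E; exact: kE.
have k0 : 0 < kappa by lra.
pose b := pi / kappa; have b0 : 0 < b by rewrite divr_gt0.
(* From [c >= 8] follow [a >= 2] and [kappa > 4 > pi]. Hence [4 * b <= 4], the additive constant of
   the bound. *)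
have b1 : b <= 1 by rewrite /b ler_pdivrMr// mul1r; rewrite /a in ka; lra.
have ab : 4 * a * b <= 100 / 81 * pi.
  rewrite /b mulrA ler_pdivrMr//.
  have -> : 4 * a * pi = 100 / 81 * pi * (81 / 25 * a) by field.
  by rewrite ler_pM2l// mulr_gt0.
have Em : lebesgue2 R (superellipse a b) = pi%:E.
  by rewrite area// /b; congr EFin; rewrite divfK// gt_eqF.
have lna : ln a = ln (c / 2) - ln 2.
  by rewrite -ln_div ?posrE//; [congr ln; rewrite /a; field|lra].
have key : 4 * a + 4 * b + lam * ((- ln a * pi + 4 * a * b) * pi) <=
    3 * c - c * ln (c / 2) + 4.
  have -> : lam * ((- ln a * pi + 4 * a * b) * pi) = c * (ln 2 - ln (c / 2)) + lam * pi * (4 * a * b).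
    by rewrite lna /c; ring.
  have : lam * pi * (4 * a * b) <= lam * pi * (100 / 81 * pi) by rewrite ler_pM2l// mulr_gt0.
  have -> : lam * pi * (100 / 81 * pi) = 100 / 81 * c by rewrite /c; ring.
  have : c * ln 2 <= c * (19 / 25) by rewrite ler_pM2l ?ln2_le//; lra.
  rewrite mulrBr (_ : 4 * a = c); last by rewrite /a; field.
  lra.
exists a, b; split => // C CE.
have mE := superellipse_measurable a0 b0.
have Eb y : superellipse a b y -> `](- b), b[%classic y.2.
  by move: y => [x y] /(superellipse_slice1 x y a0 b0)[].
have le1 := le_trans (relaxed_perimeter_le CE) (superellipse_perimeter_le a0 b0).
have le2 := log_energy_le a0 b0 mE Em Eb.
rewrite /energy ifF; last first.
  by apply/negbTE; rewrite -ltey; apply: le_lt_trans le1 _; rewrite ltry.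
apply: (@le_trans _ _ (4 * a + 4 * b + lam * ((- ln a * pi + 4 * a * b) * pi))%:E); last first.
  by rewrite lee_fin.
rewrite EFinD; apply: leeD => //.
by rewrite EFinM; apply: lee_wpmul2l => //; rewrite lee_fin ltW.
Qed.

(** The threshold adds those of [energy_ge] and [exists_competitor], both stated for
    [pi ^+ 2 * lam], which is at least [lam]. *)
Lemma min_energy_bounds (C : set (set (R * R))) (lam : R) :
  (forall A, C A -> connected A /\ smooth_set A) ->
  (forall a b : R, 0 < a -> 0 < b -> C (superellipse a b)) ->
  2 * expR 1 + 8 <= lam ->
  exists2 e : R, min_energy C lam = e%:E &
    pi ^+ 2 * lam - 1 <= e + pi ^+ 2 * lam * ln (pi ^+ 2 * lam / 2) <= 3 * (pi ^+ 2 * lam) + 4.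
Proof.
move=> Cc Cs laml.
have e10 := expR_gt0 (1 : R).
have lam0 : 0 < lam by lra.
have cl : lam <= pi ^+ 2 * lam.
  rewrite ler_peMl ?ltW//; have := @pi_ge2 R => p2; rewrite expr2; nra.
have low : ((pi ^+ 2 * lam - pi ^+ 2 * lam * ln (pi ^+ 2 * lam / 2) - 1)%:E <= min_energy C lam)%E.
  apply: le_ereal_inf_tmp => _ [E [mE Em] <-].
  by apply: energy_ge => //; lra.
have [a [b [a0 b0 Em en]]] : exists a b : R, [/\ 0 < a, 0 < b, lebesgue2 R (superellipse a b) = pi%:E &
    forall C : set (set (R * R)), C (superellipse a b) ->
    (energy C lam (superellipse a b) <=
      (3 * (pi ^+ 2 * lam) - pi ^+ 2 * lam * ln (pi ^+ 2 * lam / 2) + 4)%:E)%E].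
  by apply: exists_competitor => //; lra.
have up : (min_energy C lam <= (3 * (pi ^+ 2 * lam) - pi ^+ 2 * lam * ln (pi ^+ 2 * lam / 2) + 4)%:E)%E.
  apply: le_trans (en C (Cs a b a0 b0)); apply: ereal_inf_lbound.
  by exists (superellipse a b) => //; split => //; exact: superellipse_measurable.
move: low up; case: (min_energy C lam) => [e| |]//; rewrite ?leeNy_eq ?leye_eq//.
by rewrite !lee_fin => low up; exists e => //; lra.
Qed.

(** [X / lam] leaves the interval from [P] to [3 * P] by at most [4 / lam], so cutting it off
    changes its multiple by [lam] by at most 4. *)
Lemma clamp_coefficient (P lam X : R) : 0 <= P -> 0 < lam ->
  P * lam - 1 <= X <= 3 * (P * lam) + 4 ->
  let t := Num.max P (Num.min (3 * P) (X / lam)) in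
  P <= t <= 3 * P /\ `|X - t * lam| <= 4.
Proof.
move=> P0 lam0 /andP[lo hi] t.
have XE : X = X / lam * lam by rewrite divfK// gt_eqF.
rewrite /t; case: (leP (3 * P) (X / lam)) => [xP|xP].
  rewrite max_r; last lra.
  split; first lra.
  have : 3 * P * lam <= X by rewrite {1}XE ler_pM2r.
  by rewrite ler_norml; lra.
case: (leP P (X / lam)) => [Px|Px]; first by split; [lra|rewrite -XE subrr normr0].
split; first lra.
have : X <= P * lam by rewrite XE ler_pM2r// ltW.
by rewrite ler_norml; lra.
Qed.

Lemma min_energy_coefficient (C : set (set (R * R))) :
  (forall A, C A -> connected A /\ smooth_set A) ->
  (forall a b : R, 0 < a -> 0 < b -> C (superellipse a b)) ->
  exists t : R -> R, forall lam, 2 * expR 1 + 8 <= lam ->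
    pi ^+ 2 <= t lam <= 3 * pi ^+ 2 /\
    (`|min_energy C lam - (- pi ^+ 2 * lam * ln (pi ^+ 2 * lam / 2) + t lam * lam)%:E| <= 4%:E)%E.
Proof.
move=> Cc Cs.
pose X lam := fine (min_energy C lam) + pi ^+ 2 * lam * ln (pi ^+ 2 * lam / 2).
exists (fun lam => Num.max (pi ^+ 2) (Num.min (3 * pi ^+ 2) (X lam / lam))) => lam laml.
have lam0 : 0 < lam by apply: lt_le_trans laml; rewrite ltr_wpDl// mulr_ge0 ?expR_ge0.
have [e eE eb] := min_energy_bounds Cc Cs laml.
have Xb : pi ^+ 2 * lam - 1 <= X lam <= 3 * (pi ^+ 2 * lam) + 4 by rewrite /X eE.
have [tb td] := clamp_coefficient (sqr_ge0 pi) lam0 Xb; split => //.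
rewrite eE -EFinB abse_EFin lee_fin.
move: td; rewrite /X eE /=; set t := Num.max _ _ => td.
rewrite (_ : _ - _ = e + pi ^+ 2 * lam * ln (pi ^+ 2 * lam / 2) - t * lam)//.
by ring.
Qed.

Lemma simply_connected_smooth_superellipse (a b : R) : 0 < a -> 0 < b ->
  simply_connected_smooth (superellipse a b).
Proof.
move=> a0 b0; split; last exact: superellipse_smooth.
exact/convex_simply_connected/superellipse_convex.
Qed.

Lemma simply_connected_smooth_connected (A : set (R * R)) :
  simply_connected_smooth A -> connected_smooth A.
Proof. by move=> [[pA _] sA]; split => //; exact: path_connected_connected. Qed.

End Assembly.

Theorem theorem3p9 (R : realType) :
  exists (tC tS : R -> R) (M : R), \forall lam \near +oo,
    [/\ pi ^+ 2 <= tC lam <= 3 * pi ^+ 2,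
        pi ^+ 2 <= tS lam <= 3 * pi ^+ 2,
        (`|e_C lam - (- pi ^+ 2 * lam * ln (pi ^+ 2 * lam / 2)
                      + tC lam * lam)%:E| <= M%:E)%E &
        (`|e_S lam - (- pi ^+ 2 * lam * ln (pi ^+ 2 * lam / 2)
                      + tS lam * lam)%:E| <= M%:E)%E].
Proof.
have sS (a b : R) : 0 < a -> 0 < b -> connected_smooth (superellipse a b).
  by move=> a0 b0; exact/simply_connected_smooth_connected/simply_connected_smooth_superellipse.
have [tC HC] := @min_energy_coefficient R connected_smooth (fun A => id) sS.
have [tS HS] := @min_energy_coefficient R simply_connected_smooth
  (@simply_connected_smooth_connected R) (@simply_connected_smooth_superellipse R).
exists tC, tS, 4; near=> lam.
have laml : 2 * expR 1 + 8 <= lam by near: lam; exact: nbhs_pinfty_ge.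
by have [? ?] := HC _ laml; have [? ?] := HS _ laml; split.
Unshelve. all: by end_near. Qed.
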